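(* Let $D$ be a non-commutative division ring. Then the following statements hold: (1) The graph $\Delta(D^* )$ is complete. (2) Let $D'=[D^*,D^*]$ be the derived subgroup of $D^*$. If $N$ is a vertex of $\Delta(D^* )$, then either $N$ is normal in $D^*$, or $N\cap D'$ is a proper subgroup of $D'$ and $N\cap D'$ is itself a vertex of $\Delta(D^* )$. (3) The vertex set of $\Delta(D^* )$ contains no finite subgroups of $D^*$.
   Context: $D^*$ is the multiplicative group of $D$. A subgroup $N$ of a group $G$ is almost subnormal in $G$ if there is a finite chain of subgroups $N=N_r\le N_{r-1}\le\dots\le N_1\le N_0=G$ such that for every $0\le i<r$, either $N_{i+1}$ is normal in $N_i$ or the index $[N_i:N_{i+1}]$ is finite. The intersection graph $\Gamma(G)$ of a group $G$ has as vertices all non-trivial proper subgroups of $G$; two distinct vertices $A,B$ are adjacent if $A\cap B\ne 1$. $\Delta(D^* )$ is the induced subgraph of $\Gamma(D^* )$ whose vertices are all proper subgroups of $D^*$ that are non-central (i.e. not contained in the center of $D$) and almost subnormal in $D^*$. A graph is complete if any two distinct vertices are adjacent. *)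

(* Defs.v *)
From HB Require Import structures.
From mathcomp Require Import all_boot all_algebra.
From mathcomp Require Import boolp classical_sets functions cardinality.

Set Implicit Arguments.
Unset Strict Implicit.
Unset Printing Implicit Defensive.

Import GRing.Theory.
Local Open Scope classical_set_scope.

(* {unit R} from finalg requires R to be finite, hence this type. *)
Section UnitGroup.
Variable R : unitRingType.
Local Open Scope ring_scope.

Record unit_group := UnitGroup {
  unit_val : R;
  unit_valP : unit_val \is a GRing.unit
}.

HB.instance Definition _ := [isSub for unit_val].
HB.instance Definition _ := [Choice of unit_group by <:].

Implicit Types u v : unit_group.

Definition unit_group1 := UnitGroup (@unitr1 R).

Fact unit_group_inv_subproof u : (unit_val u)^-1 \is a GRing.unit.
Proof. by rewrite unitrV (unit_valP u). Qed.
Definition unit_group_inv u := UnitGroup (unit_group_inv_subproof u).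

Fact unit_group_mul_subproof u v :
  unit_val u * unit_val v \is a GRing.unit.
Proof. by rewrite (unitrMr _ (unit_valP u)) (unit_valP v). Qed.
Definition unit_group_mul u v := UnitGroup (unit_group_mul_subproof u v).

Fact unit_group_mulA : associative unit_group_mul.
Proof. by move=> u v w; apply/val_inj/mulrA. Qed.
Fact unit_group_mul1 : left_id unit_group1 unit_group_mul.
Proof. by move=> u; apply/val_inj/mul1r. Qed.
Fact unit_group_1mul : right_id unit_group1 unit_group_mul.
Proof. by move=> u; apply/val_inj/mulr1. Qed.
Fact unit_group_mulV : left_inverse unit_group1 unit_group_inv unit_group_mul.
Proof. by move=> u; apply/val_inj/(mulVr (unit_valP u)). Qed.
Fact unit_group_Vmul : right_inverse unit_group1 unit_group_inv unit_group_mul.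
Proof. by move=> u; apply/val_inj/(mulrV (unit_valP u)). Qed.

HB.instance Definition _ := isGroup.Build unit_group
  unit_group_mulA unit_group_mul1 unit_group_1mul
  unit_group_mulV unit_group_Vmul.

Definition ring_center : set R := [set x | forall y, x * y = y * x].

End UnitGroup.

Section Groups.
Variable G : groupType.
Local Open Scope group_scope.
Implicit Types H K N : set G.

Definition subgroup H : Prop := group_closed [in H].

Definition proper_subgroup H K : Prop := [/\ subgroup H, H `<=` K & H <> K].

Definition normal_in K H : Prop :=
  K `<=` H /\ forall x y, H x -> K y -> K (y ^ x).

Definition lcoset x K : set G := [set x * y | y in K].

Definition finite_index H K : Prop :=
  K `<=` H /\ finite_set [set lcoset x K | x in H].

Definition derived_subgroup : set G :=
  smallest subgroup [set [~ x, y] | x in setT & y in setT].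

(* Only [c 0], ..., [c r] are relevant; the other values of [c] are junk. *)
Definition almost_subnormal N : Prop :=
  exists (r : nat) (c : nat -> set G),
    [/\ c 0 = setT, c r = N,
        forall i, i <= r -> subgroup (c i) &
        forall i, i < r ->
          c i.+1 `<=` c i /\
          (normal_in (c i.+1) (c i) \/ finite_index (c i) (c i.+1))].

End Groups.

Arguments derived_subgroup : clear implicits.

Record graph (T : Type) := Graph {
  vertices : set T;
  adjacent : T -> T -> Prop;
  adjacent_vertices : forall a b, adjacent a b -> vertices a /\ vertices b;
  adjacent_sym : forall a b, adjacent a b -> adjacent b a;
  adjacent_irr : forall a, ~ adjacent a a
}.

Definition complete T (g : graph T) : Prop :=
  forall a b, vertices g a -> vertices g b -> a <> b -> adjacent g a b.

Section InducedSubgraph.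
Variables (T : Type) (g : graph T) (W : set T).

Let V := vertices g `&` W.
Let adj a b := [/\ V a, V b & adjacent g a b].

Fact induced_vertices a b : adj a b -> V a /\ V b.
Proof. by case. Qed.
Fact induced_sym a b : adj a b -> adj b a.
Proof. by case=> Va Vb gab; split=> //; apply: adjacent_sym. Qed.
Fact induced_irr a : ~ adj a a.
Proof. by case=> _ _; apply: adjacent_irr. Qed.

Definition induced_subgraph : graph T :=
  Graph induced_vertices induced_sym induced_irr.

End InducedSubgraph.

Section IntersectionGraph.
Variable G : groupType.
Local Open Scope group_scope.

Let V : set (set G) :=
  [set A | proper_subgroup A setT /\ A <> [set 1]].
Let adj (A B : set G) := [/\ V A, V B, A <> B & A `&` B <> [set 1]].

Fact intersection_vertices A B : adj A B -> V A /\ V B.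
Proof. by case. Qed.
Fact intersection_sym A B : adj A B -> adj B A.
Proof.
by case=> VA VB nAB nI; split=> //; [move=> eBA; apply: nAB | rewrite setIC].
Qed.
Fact intersection_irr A : ~ adj A A.
Proof. by case. Qed.

Definition intersection_graph : graph (set G) :=
  Graph intersection_vertices intersection_sym intersection_irr.

End IntersectionGraph.

Definition non_central (R : unitRingType) (N : set (unit_group R)) : Prop :=
  ~ (@unit_val R @` N `<=` @ring_center R).

Definition Delta (D : unitRingType) : graph (set (unit_group D)) :=
  induced_subgraph (intersection_graph (unit_group D))
    [set N | non_central N /\ almost_subnormal N].

(* Main.v *)
From HB Require Import structures.
Require Import Defs.
From mathcomp Require Import all_boot all_algebra.
From mathcomp Require Import boolp classical_sets functions cardinality.
From mathcomp Require Import finmap finfield.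

(** All three statements come from two facts about a noncentral almost subnormal
subgroup [N] of [D^*]: it meets every other such subgroup in a noncentral
subgroup, and it is infinite modulo the centre.  The second one is
[asubnorm_central_by_finite], the first one [asubnorm_noncentralI]; applied to
[N] and to the derived subgroup, the latter gives part (2), because a subgroup
containing all commutators is normal.

Both facts reduce to a theorem on honest subnormal subgroups, Stuth's theorem
that the centralizer in [D] of a noncentral subnormal subgroup [M] is the centre
([trivial_centralizers_setT]).  Indeed an almost subnormal group contains a
subnormal one of finite index.  If [N], normal in [N'], is finite modulo the
centre, then [N'] acts on a finite set generating [N] modulo the centre, so the
centralizer of [N] has finite index in [N']; it is central by Stuth's theorem,
and one climbs up the chain to [D^*], where the claim is easy.  For the
intersections one takes commutators along the two chains.

For Stuth's theorem let [M] be normal in [Q], the next term of its chain, let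
[E] be the centralizer of [M] and [K] the centralizer of [E]; both are
normalized by [Q], [M] lies in [K], and by induction the centralizer of [Q] is
the centre.  For [a] in [M] and any nonzero [y] the iterated commutator with
[w_0 = y] and [w_(i+1) = a w_i a^-1 w_i^-1] ends in [M].  Take
[y = 1 + c q t] with [c] in [K], where [q] normalizes [K] and is outside [K], and
where [t] is a parameter commuting with everything.  Then
[w_r = 1 + delta^r(c q) t + ..], where [delta] is the conjugation by [a] minus
the identity.  As [w_r] lies in [K] and its first coefficient lies in [K q], this
coefficient vanishes.  So [a] acts unipotently on [K q], and therefore
([unipotent_exponent]) [a] commutes with [K] and [q] in characteristic 0, and
some power [a^(p^s)], with [s] independent of [a], does in characteristic [p].
Varying [q], these powers are central.  That in turn makes [M] central
([radical_subnorm_central]): otherwise there are [b] in [M] and [x] with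
[b x b^-1 = x + 1], and the iterated commutators of [b] and [x] lead to
[b x b^-1 = x].

The expansion needs a justification.  Products of factors [(1 + v_i t)^(+-1)] are
written as left fractions of skew polynomials by an explicit Ore condition
([evs_fraction]).  If the centre of [D] is infinite, [t] runs over the central
elements ([word_comm_delta]).  If it is finite, [t = 1] is enough when the powers
of [q] are left independent over [K] ([word_const_delta]), and there are two
cases.  If the common centre of [E] and [K] is not central in [D], it is a field
normalized by [Q], and one works with this field and its centralizer in place of
[E] and [K].  Independence can then only fail if some power of [q] centralizes
the field although [q] does not; this is impossible, because a suitable
centralizer is a division ring with infinite centre, to which the previous case
applies ([finite_order_trivial]).  Otherwise [E] is not commutative, and by a
variant of Jacobson's theorem ([torsion_comm]), which rests on Wedderburn's
little theorem, it contains an element [q] of infinite order, whose powers are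
independent over [K]. *)


Set Implicit Arguments.
Unset Strict Implicit.
Unset Printing Implicit Defensive.

Import GRing.Theory.
Local Open Scope classical_set_scope.
Local Open Scope ring_scope.

(** * Division rings: conjugation, division subrings, centralizers *)

(** Division rings: unit rings all of whose nonzero elements are units. *)
Structure divRing := DivRing {
  divRing_sort :> unitRingType;
  divRing_unit : forall x : divRing_sort, x != 0 -> x \is a GRing.unit
}.

Section Basics.
Variable D : divRing.
Implicit Types (x y z a b g h q : D) (K A P Q M S : set D).

Let Ddiv := @divRing_unit D.

Lemma mulVd x : x != 0 -> x^-1 * x = 1.
Proof. by move=> /Ddiv /mulVr. Qed.

Lemma mulfVd x : x != 0 -> x * x^-1 = 1.
Proof. by move=> /Ddiv /mulrV. Qed.

Lemma mulKd x y : x != 0 -> x^-1 * (x * y) = y.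
Proof. by move=> /Ddiv /mulKr. Qed.

Lemma mulVKd x y : x != 0 -> x * (x^-1 * y) = y.
Proof. by move=> /Ddiv /mulVKr. Qed.

Lemma mulfKd x y : x != 0 -> y * x * x^-1 = y.
Proof. by move=> /Ddiv ux; rewrite mulrK. Qed.

Lemma mulfVKd x y : x != 0 -> y * x^-1 * x = y.
Proof. by move=> /Ddiv ux; rewrite mulrVK. Qed.

Lemma mulfd_neq0 x y : x != 0 -> y != 0 -> x * y != 0.
Proof.
move=> x0 y0; apply: contra_neq y0 => xy0.
by rewrite -(mulKd y x0) xy0 mulr0.
Qed.

Lemma mulfd_eq0 x y : x * y = 0 -> x = 0 \/ y = 0.
Proof.
move=> xy; have [|x0] := eqVneq x 0; [by left | right].
by rewrite -(mulKd y x0) xy mulr0.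
Qed.

Lemma invd_neq0 x : x != 0 -> x^-1 != 0.
Proof. by rewrite invr_eq0. Qed.

Lemma expd_neq0 x n : x != 0 -> x ^+ n != 0.
Proof.
move=> x0; elim: n => [|n IH]; first by rewrite expr0 oner_eq0.
by rewrite exprS mulfd_neq0.
Qed.

Lemma expd_eq0 x n : x ^+ n = 0 -> x = 0.
Proof. by move=> xn; apply/eqP/negPn/negP => /(expd_neq0 n); rewrite xn eqxx. Qed.

Lemma mulId x y z : z != 0 -> x * z = y * z -> x = y.
Proof. by move=> z0 e; rewrite -(mulfKd x z0) e mulfKd. Qed.

Lemma mulLd x y z : z != 0 -> z * x = z * y -> x = y.
Proof. by move=> z0 e; rewrite -(mulKd x z0) e mulKd. Qed.

Lemma invMd x y : x != 0 -> y != 0 -> (x * y)^-1 = y^-1 * x^-1.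
Proof. by move=> /Ddiv ? /Ddiv ?; rewrite invrM. Qed.

(** Conjugation [x |-> g x g^-1]; a left action, unlike the [x ^ g] of group
theory. *)
Definition cj g x := g * x * g^-1.

Lemma cjB g x y : cj g (x - y) = cj g x - cj g y.
Proof. by rewrite /cj mulrBr mulrBl. Qed.

Lemma cjD g x y : cj g (x + y) = cj g x + cj g y.
Proof. by rewrite /cj mulrDr mulrDl. Qed.

Lemma cj0 g : cj g 0 = 0.
Proof. by rewrite /cj mulr0 mul0r. Qed.

Lemma cjN g x : cj g (- x) = - cj g x.
Proof. by rewrite /cj mulrN mulNr. Qed.

Lemma cjM g x y : g != 0 -> cj g (x * y) = cj g x * cj g y.
Proof. by move=> g0; rewrite /cj !mulrA mulfVKd. Qed.

Lemma cj1 g : g != 0 -> cj g 1 = 1.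
Proof. by move=> g0; rewrite /cj mulr1 mulfVd. Qed.

Lemma cjcj g h x : g != 0 -> h != 0 -> cj g (cj h x) = cj (g * h) x.
Proof. by move=> g0 h0; rewrite /cj invMd // !mulrA. Qed.

Lemma cjK g x : g != 0 -> cj g^-1 (cj g x) = x.
Proof. by move=> g0; rewrite /cj invrK !mulrA mulVd // mul1r mulfVKd. Qed.

Lemma cjVK g x : g != 0 -> cj g (cj g^-1 x) = x.
Proof. by move=> g0; rewrite -{1}(invrK g) cjK // invd_neq0. Qed.

Lemma cj_neq0 g x : g != 0 -> x != 0 -> cj g x != 0.
Proof. by move=> g0 x0; rewrite /cj !mulfd_neq0 // invd_neq0. Qed.

Lemma cjV g x : g != 0 -> x != 0 -> cj g x^-1 = (cj g x)^-1.
Proof.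
move=> g0 x0; rewrite /cj !invMd ?invrK ?mulfd_neq0 ?invd_neq0 //.
by rewrite mulrA.
Qed.

Lemma cj_swap g x : g != 0 -> g * x = cj g x * g.
Proof. by move=> g0; rewrite /cj mulfVKd. Qed.

Lemma cj_id g x : g != 0 -> (cj g x = x) <-> (g * x = x * g).
Proof.
move=> g0; split=> [e|e]; first by rewrite cj_swap // e.
by rewrite /cj e mulfKd.
Qed.

Lemma cjX g x n : g != 0 -> cj g (x ^+ n) = cj g x ^+ n.
Proof.
move=> g0; elim: n => [|n IH]; first by rewrite !expr0 cj1.
by rewrite !exprS cjM // IH.
Qed.

Lemma iter_cj g x n : g != 0 -> iter n (cj g) x = cj (g ^+ n) x.
Proof.
move=> g0; elim: n => [|n IH]; first by rewrite expr0 /cj invr1 mulr1 mul1r.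
by rewrite iterS IH cjcj ?expd_neq0 // -exprS.
Qed.

(** Division subrings of [D], as sets.  As [0^-1 = 0], closure under inverses
needs no side condition. *)
Definition divsub K := [/\ K 1, forall x y, K x -> K y -> K (x - y),
  forall x y, K x -> K y -> K (x * y) & forall x, K x -> K x^-1].

Section DivsubTheory.
Variables (K : set D) (dK : divsub K).

Lemma divsub1 : K 1. Proof. by case: dK. Qed.
Lemma divsubB x y : K x -> K y -> K (x - y).
Proof. by case: dK => _ + _ _; exact. Qed.
Lemma divsubM x y : K x -> K y -> K (x * y).
Proof. by case: dK => _ _ + _; exact. Qed.
Lemma divsubV x : K x -> K x^-1. Proof. by case: dK => _ _ _; exact. Qed.
Lemma divsub0 : K 0.
Proof. by rewrite -(subrr 1); apply: divsubB divsub1 divsub1. Qed.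
Lemma divsubN x : K x -> K (- x).
Proof. by rewrite -sub0r; apply: divsubB divsub0. Qed.
Lemma divsubD x y : K x -> K y -> K (x + y).
Proof.
by move=> Kx Ky; rewrite -(opprK y); apply: divsubB => //; apply: divsubN.
Qed.
Lemma divsubX x n : K x -> K (x ^+ n).
Proof.
move=> Kx; elim: n => [|n IH]; first exact: divsub1.
by rewrite exprS; apply: divsubM.
Qed.
Lemma divsub_nat n : K n%:R.
Proof.
elim: n => [|n IH]; first exact: divsub0.
by rewrite -natr1; apply: divsubD IH divsub1.
Qed.
Lemma divsub_sum (I : Type) (r : seq I) (F : I -> D) :
  (forall i, K (F i)) -> K (\sum_(i <- r) F i).
Proof. by move=> KF; apply: big_ind => //; [exact: divsub0 | exact: divsubD]. Qed.
Lemma divsub_cj g x : K g -> K x -> K (cj g x).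
Proof. by move=> Kg Kx; apply: divsubM (divsubV Kg); apply: divsubM. Qed.

End DivsubTheory.

Lemma divsubT : divsub setT.
Proof. by split. Qed.

Lemma divsubI K A : divsub K -> divsub A -> divsub (K `&` A).
Proof.
move=> dK dA; split.
- by split; apply: divsub1.
- by move=> x y [? ?] [? ?]; split; apply: divsubB.
- by move=> x y [? ?] [? ?]; split; apply: divsubM.
- by move=> x [? ?]; split; apply: divsubV.
Qed.

(** The centralizer of a set. *)
Definition cent S : set D := [set x | forall y, S y -> x * y = y * x].

Lemma divsub_cent S : divsub (cent S).
Proof.
split.
- by move=> y _; rewrite mul1r mulr1.
- by move=> x y Cx Cy z Sz; rewrite mulrBl mulrBr Cx // Cy.
- by move=> x y Cx Cy z Sz; rewrite -mulrA Cy // !mulrA Cx.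
- by move=> x Cx y Sy; apply/esym/commrV/esym/Cx.
Qed.

Lemma cent_cent S : S `<=` cent (cent S).
Proof. by move=> x Sx y /(_ x Sx). Qed.

Lemma centS S T : S `<=` T -> cent T `<=` cent S.
Proof. by move=> ST x Cx y /ST /Cx. Qed.

(** The centre of a division subring [A]. *)
Definition Zc A : set D := A `&` cent A.

Lemma divsub_Zc A : divsub A -> divsub (Zc A).
Proof. by move=> dA; apply: divsubI (divsub_cent A). Qed.

(** Subgroups of [D^*]. *)
Definition mgroup P := [/\ P 1, forall x, P x -> x != 0,
  forall x y, P x -> P y -> P (x * y) & forall x, P x -> P x^-1].

(** The multiplicative group of [A]. *)
Definition mstar A : set D := [set x | A x /\ x != 0].

Section MgroupTheory.
Variables (P : set D) (gP : mgroup P).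
Lemma mgroup1 : P 1. Proof. by case: gP. Qed.
Lemma mgroup_neq0 x : P x -> x != 0. Proof. by case: gP => _ + _ _; exact. Qed.
Lemma mgroupM x y : P x -> P y -> P (x * y).
Proof. by case: gP => _ _ + _; exact. Qed.
Lemma mgroupV x : P x -> P x^-1. Proof. by case: gP => _ _ _; exact. Qed.
Lemma mgroupX x n : P x -> P (x ^+ n).
Proof.
move=> Px; elim: n => [|n IH]; first exact: mgroup1.
by rewrite exprS; apply: mgroupM.
Qed.
Lemma mgroup_cj g x : P g -> P x -> P (cj g x).
Proof. by move=> Pg Px; apply: mgroupM (mgroupV Pg); apply: mgroupM. Qed.
End MgroupTheory.

Lemma mgroup_mstar A : divsub A -> mgroup (mstar A).
Proof.
move=> dA; split.
- by split; [exact: divsub1 | exact: oner_neq0].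
- by move=> x [].
- by move=> x y [Ax x0] [Ay y0]; split; [exact: divsubM | exact: mulfd_neq0].
- by move=> x [Ax x0]; split; [exact: divsubV | exact: invd_neq0].
Qed.

Lemma mgroupI P Q : mgroup P -> mgroup Q -> mgroup (P `&` Q).
Proof.
move=> gP gQ; split.
- by split; apply: mgroup1.
- by move=> x [/(mgroup_neq0 gP)].
- by move=> x y [? ?] [? ?]; split; apply: mgroupM.
- by move=> x [? ?]; split; apply: mgroupV.
Qed.

Lemma mgroupI_divsub P A : mgroup P -> divsub A -> mgroup (P `&` A).
Proof.
move=> gP dA; split.
- by split; [apply: mgroup1 | apply: divsub1].
- by move=> x [/(mgroup_neq0 gP)].
- by move=> x y [? ?] [? ?]; split; [apply: mgroupM | apply: divsubM].
- by move=> x [? ?]; split; [apply: mgroupV | apply: divsubV].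
Qed.

(** The group [Q] normalizes the set [P]. *)
Definition normed Q P := forall x y, Q x -> P y -> P (cj x y).

Lemma normed_cent Q S : mgroup Q -> normed Q S -> normed Q (cent S).
Proof.
move=> gQ nS x y Qx Cy z Sz.
have x0 := mgroup_neq0 gQ Qx.
rewrite -(cjVK z x0) -!cjM // Cy //.
by apply: nS => //; apply: mgroupV.
Qed.

Lemma normedI Q P S : normed Q P -> normed Q S -> normed Q (P `&` S).
Proof. by move=> nP nS x y Qx [Py Sy]; split; [apply: nP | apply: nS]. Qed.

End Basics.

(** * Finite index *)

Section FiniteIndex.
Variable D : divRing.
Implicit Types (x y z a b g q : D) (H K G A P Q M S : set D).

(** [fincol H G]: the elements of [G] can be coloured with finitely many colours
so that [x^-1 y] lies in [H] for [x], [y] of the same colour.  For a subgroup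
[H] of [G], this says that [H] has finite index in [G]. *)
Definition fincol H G := exists (T : finType) (f : D -> T),
  forall x y, G x -> G y -> f x = f y -> H (x^-1 * y).

Lemma fincolS H H' G G' : H `<=` H' -> G' `<=` G -> fincol H G -> fincol H' G'.
Proof.
move=> sH sG [T [f fP]]; exists T, f => x y /sG Gx /sG Gy e.
exact/sH/fP.
Qed.

(** Representatives of the colours, inside [G]; [x0] serves for the colours not
taken on [G]. *)
Lemma colour_rep (T : Type) (f : D -> T) G x0 : G x0 ->
  exists2 rep : T -> D, forall c, G (rep c) &
    forall g, G g -> f (rep (f g)) = f g.
Proof.
move=> G0.
have hex c : exists r, G r /\ forall g, G g -> f g = c -> f r = c.
  have [[g [Gg <-]]|none] := pselect (exists g, G g /\ f g = c).
    by exists g.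
  by exists x0; split=> // g Gg e; case: none; exists g.
have [rep repP] := choice hex; exists rep => [c|g Gg]; first by case: (repP c).
by case: (repP (f g)) => _ /(_ g Gg erefl).
Qed.

(** The second colouring is applied to the quotient of an element by the
representative of its colour. *)
Lemma fincol_trans H K G : mgroup G -> fincol H G -> fincol K H -> fincol K G.
Proof.
move=> gG [T [f fP]] [U [h hP]].
have [rep Grep frep] := colour_rep f (mgroup1 gG).
exists (T * U)%type, (fun g => (f g, h ((rep (f g))^-1 * g))).
move=> x y Gx Gy [exy]; have Gr := Grep (f x); have fr := frep x Gx.
rewrite -exy => e.
have := hP _ _ (fP _ _ Gr Gx fr) (fP _ _ Gr Gy (etrans fr exy)) e.
have r0 := mgroup_neq0 gG Gr; have x0 := mgroup_neq0 gG Gx.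
by rewrite invMd ?invd_neq0 // invrK -mulrA mulVKd.
Qed.

Lemma fincolI H1 H2 G : fincol H1 G -> fincol H2 G -> fincol (H1 `&` H2) G.
Proof.
move=> [T [f fP]] [U [h hP]]; exists (T * U)%type, (fun g => (f g, h g)).
by move=> x y Gx Gy [e1 e2]; split; [apply: fP | apply: hP].
Qed.

Lemma fincol_cap H G K : mgroup K -> fincol H G -> fincol (H `&` K) (G `&` K).
Proof.
move=> gK [T [f fP]]; exists T, f => x y [Gx Kx] [Gy Ky] e; split.
  exact: fP.
by apply: mgroupM => //; apply: mgroupV.
Qed.

(** The normal core of [H] in [G]. *)
Definition core H G : set D := [set x | G x /\ forall g, G g -> H (cj g x)].

Lemma mgroup_core H G : mgroup H -> mgroup G -> mgroup (core H G).
Proof.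
move=> gH gG; split.
- split; first exact: mgroup1.
  by move=> g /(mgroup_neq0 gG) g0; rewrite cj1 //; apply: mgroup1.
- by move=> x [/(mgroup_neq0 gG)].
- move=> x y [Gx Hx] [Gy Hy]; split; first exact: mgroupM.
  move=> g Gg; rewrite cjM ?(mgroup_neq0 gG) //.
  by apply: mgroupM => //; [apply: Hx | apply: Hy].
- move=> x [Gx Hx]; split; first exact: mgroupV.
  by move=> g Gg; rewrite cjV ?(mgroup_neq0 gG) //; apply: (mgroupV gH); apply: Hx.
Qed.

Lemma coreS H G : mgroup G -> core H G `<=` H.
Proof.
move=> gG x [Gx /(_ 1 (mgroup1 gG))].
by rewrite /cj mul1r invr1 mulr1.
Qed.

Lemma normed_core H G : mgroup G -> normed G (core H G).
Proof.
move=> gG x y Gx [Gy Hy]; split; first exact: mgroup_cj.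
move=> g Gg; rewrite cjcj ?(mgroup_neq0 gG) //.
exact: (Hy _ (mgroupM gG Gg Gx)).
Qed.

(** The core of a subgroup of finite index has finite index: an element is
coloured by its action on the cosets of [H]. *)
Lemma fincol_core H G : mgroup H -> mgroup G -> H `<=` G ->
  fincol H G -> fincol (core H G) G.
Proof.
move=> gH gG sHG [T [f fP]].
have [rep Grep frep] := colour_rep f (mgroup1 gG).
exists {ffun T -> T}, (fun g => [ffun c => f (g * rep c)]).
move=> x y Gx Gy /ffunP e.
have Gxy : G (x^-1 * y) by apply: mgroupM => //; apply: mgroupV.
split=> // g Gg.
(* [r] represents the coset of [g^-1], and [x], [y] act on it alike. *)
have Gg' := mgroupV gG Gg; have := frep _ Gg'; set r := rep (f g^-1) => fr.
have Gr : G r by apply: Grep.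
have := e (f g^-1); rewrite !ffunE -/r => efr.
have h1 := fP _ _ (mgroupM gG Gx Gr) (mgroupM gG Gy Gr) efr.
have h2 := fP _ _ Gr Gg' fr.
have nz := mgroup_neq0 gG.
have := mgroupM gH (mgroupM gH (mgroupV gH h2) h1) h2.
have x0 := nz _ Gx; have r0 := nz _ Gr; have g0 := nz _ Gg.
rewrite !invMd ?mulfd_neq0 ?invd_neq0 // !invrK.
by congr (H _); rewrite /cj -!mulrA mulVKd // mulVKd.
Qed.

(** The centralizer in [Q] of a finite set which [Q] normalizes has finite
index. *)
Lemma fincol_cent Q S : mgroup Q -> finite_set S -> normed Q S ->
  fincol (Q `&` cent S) Q.
Proof.
move=> gQ /finite_seqP[s ->] nS.
pose f g := [ffun i : 'I_(size s) =>
  inord (index (cj g s`_i) s) : 'I_(size s).+1].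
exists {ffun 'I_(size s) -> 'I_(size s).+1}, f.
move=> x y Qx Qy /ffunP e; split.
  by apply: mgroupM => //; apply: mgroupV.
move=> z /= sz; have x0 := mgroup_neq0 gQ Qx; have y0 := mgroup_neq0 gQ Qy.
have zs : (index z s < size s)%N by rewrite index_mem.
have xz : cj x z \in s by apply: nS.
have yz : cj y z \in s by apply: nS.
have := e (Ordinal zs); rewrite !ffunE /= nth_index // => /(congr1 val) /=.
rewrite !inordK ?ltnS ?index_size // => ei.
have {}ei : cj x z = cj y z by rewrite -(nth_index 0 xz) ei nth_index.
apply/cj_id; first by rewrite mulfd_neq0 ?invd_neq0.
by rewrite -cjcj ?invd_neq0 // -ei cjK.
Qed.

End FiniteIndex.

(** * Wedderburn's little theorem *)

Section Wedderburn.
Variable D : divRing.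

Section FiniteDivsub.
Variable S : set D.
Hypothesis dS : divsub S.
Variable s : seq D.
Hypothesis sS : forall x, (x \in s) = `[< S x >].

(** A finite division subring as a type. *)
Definition wmem : {pred D} := fun x => `[< S x >].
Fact wmem_closed : divring_closed wmem.
Proof.
split.
- exact/asboolP/(divsub1 dS).
- by move=> x y /asboolP Sx /asboolP Sy; exact/asboolP/(divsubB dS).
- move=> x y /asboolP Sx /asboolP Sy; apply/asboolP/(divsubM dS) => //.
  exact: divsubV.
Qed.
HB.instance Definition _ := GRing.isDivringClosed.Build D wmem wmem_closed.

Record wtype := WType { wval : D; wvalP : wval \in wmem }.
HB.instance Definition _ := [isSub for wval].
HB.instance Definition _ := [Choice of wtype by <:].
HB.instance Definition _ := [SubChoice_isSubUnitRing of wtype by <:].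

Fact wtype_pcancel :
  pcancel (fun x : wtype => index (val x) s) (fun n => insub s`_n).
Proof.
move=> x; rewrite nth_index ?valK // sS.
exact: (wvalP x).
Qed.
HB.instance Definition _ := PCanIsCountable wtype_pcancel.

Definition wenum : seq wtype := pmap insub (undup s).
Fact wenumP : Finite.axiom wenum.
Proof.
move=> x; rewrite count_uniq_mem ?pmap_sub_uniq ?undup_uniq //.
have wx : `[< S (wval x) >] := wvalP x.
by rewrite mem_pmap_sub mem_undup sS /= wx.
Qed.
HB.instance Definition _ := isFinite.Build wtype wenumP.

Lemma wtype_comm : commutative (@GRing.mul wtype).
Proof.
apply: (@finDomain_mulrC wtype) => x y /(congr1 val); rewrite rmorph0 rmorphM /=.
by case/mulfd_eq0 => e; apply/orP; [left|right]; apply/eqP/val_inj.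
Qed.
End FiniteDivsub.

(** Wedderburn's little theorem for finite division subrings. *)
Lemma wedderburn (S : set D) : divsub S -> finite_set S ->
  forall x y, S x -> S y -> x * y = y * x.
Proof.
move=> dS /finite_seqP[s eS] x y Sx Sy.
have sS z : (z \in s) = `[< S z >].
  by rewrite eS; apply/idP/asboolP.
have wx : x \in wmem S by apply/asboolP.
have wy : y \in wmem S by apply/asboolP.
by have /(congr1 val) := @wtype_comm _ dS _ sS (WType wx) (WType wy).
Qed.

End Wedderburn.

(** * Subnormal and almost subnormal chains *)

Section Chains.
Variable D : divRing.
Implicit Types (x y z a b g q : D) (H K G A B P Q M N S : set D).

(** [subnorm A r P]: [P] is subnormal in [A^*], through a chain of [r] steps. *)
Fixpoint subnorm A (r : nat) P : Prop :=
  if r is r'.+1 then mgroup P /\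
    exists Q, [/\ subnorm A r' Q, P `<=` Q & normed Q P]
  else P = mstar A.

(** [asubnorm A r P]: [P] is almost subnormal in [A^*], through a chain of [r]
steps, each of them normal or of finite index. *)
Fixpoint asubnorm A (r : nat) P : Prop :=
  if r is r'.+1 then mgroup P /\
    exists Q, [/\ asubnorm A r' Q, P `<=` Q & normed Q P \/ fincol P Q]
  else P = mstar A.

Lemma subnorm_asubnorm A r P : subnorm A r P -> asubnorm A r P.
Proof.
elim: r P => [//|r IH] P [gP [Q [/IH aQ sPQ nQP]]].
by split=> //; exists Q; split=> //; left.
Qed.

Lemma asubnorm_mgroup A r P : divsub A -> asubnorm A r P -> mgroup P.
Proof. by move=> dA; case: r => [->|r []//]; apply: mgroup_mstar. Qed.

Lemma subnorm_mgroup A r P : divsub A -> subnorm A r P -> mgroup P.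
Proof. by move=> dA /subnorm_asubnorm; apply: asubnorm_mgroup. Qed.

Lemma asubnorm_sub A r P : asubnorm A r P -> P `<=` A.
Proof.
elim: r P => [|r IH] P; first by move=> -> x [].
by move=> [_ [Q [/IH sQ sPQ _]]] x /sPQ /sQ.
Qed.

Lemma subnorm_sub A r P : subnorm A r P -> P `<=` A.
Proof. by move/subnorm_asubnorm/asubnorm_sub. Qed.

Lemma subnorm_step A r P Q : subnorm A r Q -> mgroup P -> P `<=` Q ->
  normed Q P -> subnorm A r.+1 P.
Proof. by move=> sQ gP sPQ nQP; split=> //; exists Q. Qed.

Lemma subnorm_restrict A B r P : divsub A -> divsub B -> B `<=` A ->
  subnorm A r P -> subnorm B r (P `&` B).
Proof.
move=> dA dB sBA; elim: r P => [|r IH] P.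
  move=> ->; apply/seteqP; split=> x; first by move=> [[_ x0] Bx].
  by move=> [Bx x0]; split=> //; split=> //; apply: sBA.
move=> [gP [Q [sQ sPQ nQP]]]; split; first exact: mgroupI_divsub.
exists (Q `&` B); split; [exact: IH | exact: setSI |].
move=> x y [Qx Bx] [Py By]; split; first exact: nQP.
exact: divsub_cj.
Qed.

Lemma asubnormI A r s P Q : divsub A -> asubnorm A r P -> asubnorm A s Q ->
  exists t, asubnorm A t (P `&` Q).
Proof.
move=> dA aP aQ; elim: r P aP => [|r IH] P.
  move=> ->; exists s; rewrite (_ : _ `&` Q = Q) //.
  apply/seteqP; split=> x; first by case.
  move=> Qx; split=> //; split; first exact: asubnorm_sub aQ _ Qx.
  exact: mgroup_neq0 (asubnorm_mgroup dA aQ) _ Qx.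
move=> [gP [P' [/IH [t aP'Q] sPP' st]]].
have gQ := asubnorm_mgroup dA aQ.
exists t.+1; split; first exact: mgroupI.
exists (P' `&` Q); split=> //; first exact: setSI.
case: st => [nP|fP]; [left | right]; last exact: fincol_cap.
move=> x y [P'x Qx] [Py Qy]; split; first exact: nP.
exact: mgroup_cj.
Qed.

(** An almost subnormal subgroup contains a subnormal one of finite index: at a
step of finite index one passes to the core. *)
Lemma asubnorm_subnorm A r N : divsub A -> asubnorm A r N ->
  exists t M, [/\ subnorm A t M, M `<=` N & fincol M N].
Proof.
move=> dA; elim: r N => [|r IH] N.
  move=> ->; exists 0, (mstar A); split=> //.
  exists unit, (fun=> tt) => x y Ax Ay _.
  by apply: mgroupM (mgroupV _ Ax) Ay; apply: mgroup_mstar.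
move=> [gN [N' [aN' sNN' st]]]; have [t [M' [sM' sMN' fM']]] := IH _ aN'.
have gM' := subnorm_mgroup dA sM'; have gN' := asubnorm_mgroup dA aN'.
have gH : mgroup (M' `&` N) by apply: mgroupI.
case: st => [nN|fN].
  exists t.+1, (M' `&` N); split; last 1 first.
  - apply: fincolS (fincol_cap gN fM') => // x Nx; split=> //; exact: sNN'.
  - apply: subnorm_step sM' gH _ _; first by move=> x [].
    move=> x y M'x [M'y Ny]; split; first exact: mgroup_cj.
    by apply: nN => //; apply: sMN'.
  - by move=> x [].
have fH : fincol (M' `&` N) M'.
  rewrite setIC; apply: fincolS (fincol_cap gM' fN) => // x M'x.
  by split=> //; apply: sMN'.
exists t.+1, (core (M' `&` N) M'); split.
- apply: subnorm_step sM' _ _ _; first exact: mgroup_core.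
    by move=> x [].
  exact: normed_core.
- by move=> x /(coreS gM') [].
- have fC : fincol (core (M' `&` N) M') M' by apply: fincol_core => // x [].
  by apply: fincolS (fincol_trans gN' fM' fC).
Qed.

Lemma pigeonhole (T : finType) (f : D -> T) S : infinite_set S ->
  exists x y, [/\ S x, S y, x != y & f x = f y].
Proof.
move=> /(infinite_set_fset #|T|.+1)[B sB cB].
apply/not_existsP => none.
have inj : {in B &, injective f}.
  move=> x y Bx By e; apply/eqP/negPn/negP => nxy; apply: (none x).
  by exists y; split=> //; apply: sB.
have : uniq (map f B) by rewrite map_inj_in_uniq //; apply: fset_uniq.
move=> /card_uniqP e; have := max_card (mem (map f B)).
by rewrite e size_map leqNgt cB.
Qed.

(** If [A^*] is finite modulo the centre of [A], then [A] is commutative.  When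
the centre is infinite, [x + z] and [x + z'] have the same colour for some
central [z <> z'], and their quotient expresses [x] by central elements. *)
Lemma central_by_finite_comm A : divsub A -> fincol (Zc A) (mstar A) ->
  A `<=` cent A.
Proof.
move=> dA [T [f fP]]; have gA := mgroup_mstar dA; have dZ := divsub_Zc dA.
have [finZ|infZ] := pselect (finite_set (Zc A)).
  have [rep Grep frep] := colour_rep f (mgroup1 gA).
  suff finA : finite_set A by move=> x Ax y Ay; apply: (wedderburn dA finA).
  apply: (@sub_finite_set _ _
    ([set 0] `|` [set rep c * z | c in [set: T] & z in Zc A])); last first.
    rewrite finite_setU; split; first exact: finite_set1.
    by apply: finite_image2.
  move=> x Ax; have [->|x0] := eqVneq x 0; [by left | right].
  have Ar := Grep (f x); exists (f x) => //; exists ((rep (f x))^-1 * x).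
    by apply: fP => //; apply: frep.
  by rewrite mulVKd //; case: Ar.
move=> x Ax; apply: contrapT => nx.
have nZ z : Zc A z -> x + z != 0.
  move=> Zz; apply/eqP => e; apply: nx.
  by have -> : x = - z; [apply/eqP; rewrite -addr_eq0 e | case: (divsubN dZ Zz)].
have [z [z' [Zz Zz' nzz' /fP e]]] := pigeonhole (fun z => f (x + z)) infZ.
have {e} : Zc A ((x + z)^-1 * (x + z')).
  by apply: e; split; rewrite ?nZ //; apply: divsubD => //; [case: Zz | case: Zz'].
set u := _^-1 * _ => Zu; have e : x + z' = (x + z) * u by rewrite mulVKd ?nZ.
have u1 : 1 - u != 0.
  rewrite subr_eq0; apply: contra_neq nzz' => u1.
  by move: e; rewrite -u1 mulr1 => /addrI.
have {}e : x * (1 - u) = z * u - z'.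
  apply/eqP; rewrite mulrBr mulr1 subr_eq addrAC eq_sym subr_eq eq_sym.
  by rewrite e mulrDl addrC.
have [_] : Zc A x; last by [].
rewrite -(mulfKd x u1) e; apply: divsubM => //.
  by apply: divsubB => //; apply: divsubM.
by apply: (divsubV dZ); apply: (divsubB dZ) => //; apply: divsub1.
Qed.

End Chains.

(** * Groups which are finite modulo the centre *)

Section Fin.
Variable D : divRing.
Implicit Types (x y z a b g q : D) (H K G A B P Q M N S : set D).

Lemma uniq_roots_comm (s : seq D) : uniq s ->
  {in s &, forall x y, x * y = y * x} -> uniq_roots s.
Proof.
elim: s => [//|x s IH] /= /andP[xs us] cs; apply/andP; split; last first.
  by apply: IH => // y z ys zs; apply: cs; rewrite inE ?ys ?zs orbT.
apply/allP => y ys; rewrite /diff_roots cs ?inE ?eqxx ?ys ?orbT //=.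
apply: divRing_unit; rewrite subr_eq0.
by apply: contraNneq xs => <-.
Qed.

(** A nonzero polynomial has finitely many roots in a set of commuting
elements. *)
Lemma finite_roots (p : {poly D}) S : p != 0 -> S `<=` cent S ->
  finite_set [set x | S x /\ root p x].
Proof.
move=> p0 cS; apply: contrapT => /(infinite_set_fset (size p))[B sB].
apply/negP; rewrite -ltnNge; apply: max_ring_poly_roots => //.
  by apply/allP => x /sB[].
apply: uniq_roots_comm; first exact: fset_uniq.
by move=> x y /sB[Sx _] /sB[Sy _]; apply: cS.
Qed.

Lemma finite_unity S n : (0 < n)%N -> S `<=` cent S ->
  finite_set [set x | S x /\ x ^+ n = 1].
Proof.
move=> n0 cS; have p0 : 'X^n - 1%:P != 0 :> {poly D}.
  by rewrite -size_poly_eq0 size_XnsubC.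
apply: sub_finite_set (finite_roots p0 cS) => x /= [Sx xn]; split=> //.
by rewrite /root !hornerE hornerXn xn subrr.
Qed.

(** A group which is finite modulo the centre has finite exponent modulo the
centre. *)
Lemma central_by_finite_exp A P : divsub A -> mgroup P -> fincol (Zc A) P ->
  exists2 n, (0 < n)%N & forall x, P x -> Zc A (x ^+ n).
Proof.
move=> dA gP [T [f fP]]; have dZ := divsub_Zc dA.
exists #|T|.+1`!; first exact: fact_gt0.
move=> x Px; have x0 := mgroup_neq0 gP Px.
have [i [j [ij jT Zij]]] : exists i j : nat,
    [/\ (i < j)%N, (j <= #|T|)%N & Zc A (x ^+ (j - i))].
  pose h (i : 'I_#|T|.+1) := f (x ^+ i).
  have /injectivePn[i [j nij hij]] : ~~ injectiveb h.
    by apply/negP => /injectiveP/leq_card; rewrite card_ord ltnn.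
  have Z (k l : nat) : (k < l)%N -> f (x ^+ k) = f (x ^+ l) ->
      Zc A (x ^+ (l - k)).
    move=> kl e; have := fP _ _ (mgroupX gP k Px) (mgroupX gP l Px) e.
    by rewrite -[in x ^+ l](subnKC (ltnW kl)) exprD mulKd ?expd_neq0.
  have [ij|ji|e] := ltngtP i j; last by rewrite (val_inj e) eqxx in nij.
    by exists i, j; split=> //; [rewrite -ltnS | apply: Z].
  by exists j, i; split=> //; [rewrite -ltnS | apply: Z].
have -> : #|T|.+1`! = ((j - i) * (#|T|.+1`! %/ (j - i)))%N.
  rewrite mulnC divnK //; apply: dvdn_fact.
  by rewrite subn_gt0 ij (leq_trans (leq_subr _ _)) // leqW.
by rewrite exprM; apply: divsubX.
Qed.

(** An element of [N] has finitely many conjugates under [Q]: two of them of the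
same colour differ by a central factor, a root of unity of bounded order. *)
Lemma finite_class A N Q p : divsub A -> mgroup N -> mgroup Q -> N `<=` A ->
  Q `<=` A -> normed Q N -> fincol (Zc A) N -> N p ->
  finite_set [set cj g p | g in Q].
Proof.
move=> dA gN gQ sNA sQA nQN fN Np; have dZ := divsub_Zc dA.
have [n n0 Zn] := central_by_finite_exp dA gN fN.
have [T [f fP]] := fN; set C := image _ _.
have CN : C `<=` N by move=> _ [g Qg <-]; apply: nQN.
have Cp : C p by exists 1; [exact: mgroup1 | rewrite /cj mul1r invr1 mulr1].
have [rep Crep frep] := colour_rep f Cp.
apply: (@sub_finite_set _ _
  [set rep c * u | c in [set: T] & u in [set u | Zc A u /\ u ^+ n = 1]]).
  move=> x Cx; set c := f x; have Cc := Crep c.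
  have r0 := mgroup_neq0 gN (CN _ Cc); exists c => //; exists ((rep c)^-1 * x).
    2: by rewrite mulVKd.
  have Zu := fP _ _ (CN _ Cc) (CN _ Cx) (frep _ Cx).
  split=> //; set u := _ * x in Zu *.
  have ex : x = rep c * u by rewrite mulVKd.
  have [g Qg gp] := Cx; have [h Qh hp] := Cc.
  have g0 := mgroup_neq0 gQ Qg; have h0 := mgroup_neq0 gQ Qh.
  have e : x ^+ n = rep c ^+ n.
    have [Ap Cpn] := Zn _ Np.
    have fixn k : Q k -> cj k p ^+ n = p ^+ n.
      move=> Qk; have k0 := mgroup_neq0 gQ Qk; rewrite -cjX //.
      by apply/cj_id => //; rewrite Cpn //; apply: sQA.
    by rewrite -gp -hp !fixn.
  apply: (@mulLd _ _ _ (rep c ^+ n)); first exact: expd_neq0.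
  rewrite mulr1 -[RHS]e ex exprMn_comm //.
  by case: Zu => _ /(_ (rep c)) Zu; rewrite /GRing.comm Zu //; apply/sNA/CN.
apply: finite_image2; first exact: finite_finset.
apply: finite_unity => // x [Ax Cx] y [Ay _]; exact: Cx.
Qed.

(** The centralizer in [A] of a noncentral subnormal subgroup of [A^*] is the
centre of [A]. *)
Definition trivial_centralizers A := forall r P k, subnorm A r P -> A k ->
  cent P k -> P `<=` cent A \/ cent A k.

(** An almost subnormal subgroup finite modulo the centre is central.  If [N] is
normal in [N'] then [N'] permutes a finite set generating [N]
modulo the centre, hence the centralizer of this set has finite index in [N'].
Up to finite index it is subnormal, and it centralizes a noncentral element, so
it is central and [N'] is finite modulo the centre too. *)
Lemma asubnorm_central_by_finite A r N : divsub A -> trivial_centralizers A ->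
  asubnorm A r N -> fincol (Zc A) N -> N `<=` cent A.
Proof.
move=> dA tA; elim: r N => [|r IH] N.
  move=> -> /(central_by_finite_comm dA) cA x [Ax _]; exact: cA.
move=> [gN [N' [aN' sNN' st]]] fN.
have gN' := asubnorm_mgroup dA aN'; have sN'A := asubnorm_sub aN'.
move=> n0 Nn0; apply: contrapT => nc0.
suff fN' : fincol (Zc A) N' by apply/nc0/(IH _ aN' fN')/sNN'.
case: st => [nN|fNN']; last exact: fincol_trans fNN' fN.
have [T [f fP]] := fN; have [rep Nrep frep] := colour_rep f (mgroup1 gN).
pose C : set D := \bigcup_c [set cj g (rep c) | g in N'].
have finC : finite_set C.
  apply: bigcup_finite => [|c _]; first exact: finite_finset.
  by apply: (finite_class dA gN gN' _ sN'A nN fN (Nrep c)) => x /sNN' /sN'A.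
have nC : normed N' C.
  move=> x _ N'x [c _ [g N'g <-]]; exists c => //; exists (x * g).
    exact: mgroupM.
  by rewrite cjcj ?(mgroup_neq0 gN').
have [t [M [sM sMN' fM]]] := asubnorm_subnorm dA aN'.
have gM := subnorm_mgroup dA sM.
have sMC : subnorm A t.+1 (M `&` cent C).
  apply: subnorm_step sM _ _ _; first exact: mgroupI_divsub (divsub_cent C).
    by move=> x [].
  apply: normedI; first by move=> x y; apply: mgroup_cj.
  by apply: normed_cent => // x y /sMN'; apply: nC.
have cn0 : cent (M `&` cent C) n0.
  move=> x [Mx Cx]; have Nr := Nrep (f n0).
  have [_ cz] := fP _ _ Nr Nn0 (frep _ Nn0).
  rewrite -(mulVKd n0 (mgroup_neq0 gN Nr)) -mulrA cz; last exact/sN'A/sMN'.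
  rewrite !mulrA Cx //; exists (f n0) => //; exists 1; first exact: mgroup1.
  by rewrite /cj mul1r invr1 mulr1.
have [] := tA _ _ _ sMC _ cn0; [by apply/sN'A/sNN' | move=> cMC | by []].
apply: (fincolS _ _ (fincolI fM (fincol_cent gN' finC nC))) => //.
move=> x [Mx [_ Cx]]; split; first exact/sN'A/sMN'.
exact: cMC.
Qed.

End Fin.

(** * Iterated commutators and unipotent conjugations *)

Section Words.
Variable D : divRing.
Implicit Types (x y z a b c g q v w : D) (H K G A B P Q M N S : set D).

(** The iterated commutators [w_0 = y], [w_(r+1) = [a, w_r]]. *)
Definition word a y r := iter r (fun w => cj a w * w^-1) y.

Lemma word_neq0 a y r : a != 0 -> y != 0 -> word a y r != 0.
Proof.
move=> a0 y0; elim: r => [//|r IH].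
by rewrite /word iterS mulfd_neq0 ?invd_neq0 ?cj_neq0.
Qed.

(** The iterated commutators with [a] descend along a chain to a subnormal
subgroup containing [a]. *)
Lemma subnorm_word A r P a y : divsub A -> subnorm A r P -> P a ->
  A y -> y != 0 -> P (word a y r).
Proof.
move=> dA + + Ay y0; elim: r P => [|r IH] P; first by move=> ->.
move=> [gP [Q [sQ sPQ nQP]]] Pa; have Qw := IH _ sQ (sPQ _ Pa).
rewrite /word iterS -/(word a y r).
have -> : cj a (word a y r) * (word a y r)^-1 =
    a * cj (word a y r) a^-1 by rewrite /cj !mulrA.
by apply: mgroupM => //; apply: nQP => //; apply: mgroupV.
Qed.

(** The additive operator [cj a - 1]. *)
Definition delta a v := cj a v - v.

Lemma deltaB a v w : delta a (v - w) = delta a v - delta a w.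
Proof. by rewrite /delta cjB opprD addrACA -opprD. Qed.

(** In characteristic [p], if [cj a - 1] is nilpotent at [v], then some power of
[cj a] of [p]-power exponent fixes [v]. *)
Lemma iter_delta_pchar p r a v : p \in [pchar D] -> a != 0 ->
  iter r (delta a) v = 0 -> cj (a ^+ (p ^ r)) v = v.
Proof.
move=> cp a0; elim: r v => [|r IH] v; first by move=> /= ->; rewrite cj0.
rewrite iterSr => /IH; set b := a ^+ _; have b0 : b != 0 by apply: expd_neq0.
set u := cj b v - v => e.
have au : cj a u = u.
  rewrite /u cjB cjcj // -exprS exprSr -cjcj //; move: e; rewrite /delta -/b.
  rewrite cjB => /eqP; rewrite subr_eq => /eqP ->.
  by rewrite addrAC [X in X + _ = _]addrAC subrr add0r addrC.
have bu : cj b u = u.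
  apply/cj_id => //; apply/esym/commrX; apply/esym/cj_id => //.
have bk k : iter k (cj b) v = v + u *+ k.
  elim: k => [|k IHk]; first by rewrite addr0.
  rewrite iterS IHk cjD; have -> : cj b (u *+ k) = u *+ k.
    elim: k {IHk} => [|k IHk]; first by rewrite !mulr0n cj0.
    by rewrite !mulrS cjD IHk bu.
  by rewrite -[cj b v](subrK v) -/u addrAC -mulrS addrC.
rewrite expnSr exprM -/b -iter_cj // bk.
by rewrite mulrn_pchar // addr0.
Qed.

Lemma natr_neq0_pchar0 : (forall p, p \in [pchar D] -> False) ->
  forall n, n.+1%:R != 0 :> D.
Proof.
move=> p0 n; apply/eqP; move: {2}n.+1 (leqnn n.+1) => m.
elim: m n => [//|m IH] n nm e.
have n1 : (n.+1 != 1)%N by apply: contraPneq (oner_neq0 D) => n1; rewrite -e n1 eqxx.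
have n2 : (1 < n.+1)%N by rewrite ltn_neqAle eq_sym n1.
have pp := pdiv_prime n2; set p := pdiv n.+1 in pp.
have en : n.+1 = (n.+1 %/ p * p)%N by rewrite divnK ?pdiv_dvd.
move: e; rewrite en natrM => /mulfd_eq0[e|e]; last first.
  by apply: (p0 p); rewrite inE pp e eqxx.
have k0 : (0 < n.+1 %/ p)%N by rewrite divn_gt0 ?prime_gt0 // dvdn_leq ?pdiv_dvd.
have k1 : (n.+1 %/ p < n.+1)%N by rewrite ltn_Pdiv ?prime_gt1.
apply: (IH (n.+1 %/ p).-1); rewrite prednK //.
by rewrite -ltnS (leq_trans k1).
Qed.

(** Membership in the coset [K q]. *)
Definition rcos K q v := K (v * q^-1).

Section Unipotent.
Variables (K : set D) (a q : D).
Hypotheses (dK : divsub K) (Ka : K a) (a0 : a != 0) (q0 : q != 0).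
Hypothesis nK : forall x, K x -> K (cj q x).

Lemma rcos_cj v : rcos K q v -> rcos K q (cj a v).
Proof.
rewrite /rcos /cj => Kv.
have -> : a * v * a^-1 * q^-1 = a * (v * q^-1) * cj q a^-1.
  by rewrite /cj !mulrA mulfVKd.
by apply: (divsubM dK); [apply: (divsubM dK) | apply: nK; apply: (divsubV dK)].
Qed.

Lemma rcos_delta v n : rcos K q v -> rcos K q (iter n (delta a) v).
Proof.
move=> Kv; elim: n => [//|n IH]; rewrite iterS /delta /rcos mulrBl.
by apply: divsubB => //; apply: rcos_cj.
Qed.

(** In characteristic 0, if [cj a - 1] is nilpotent on [K q], then it vanishes
there. Otherwise [cj a x = x + 1] for some [x] in [K], and the falling
factorials of [x] contradict nilpotency. *)
Lemma iter_delta_pchar0 r : (forall p, p \in [pchar D] -> False) ->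
  (forall v, rcos K q v -> iter r (delta a) v = 0) ->
  forall v, rcos K q v -> cj a v = v.
Proof.
move=> p0 nil v Kv; apply: contrapT => av.
have ex : exists n, iter n (delta a) v == 0 by exists r; rewrite nil.
have [[|[|n]] /eqP en min_n] := ex_minnP ex.
- by case: av; move: en => /= ->; rewrite cj0.
- by case: av; apply/eqP; rewrite -subr_eq0; apply/eqP.
set y := iter n (delta a) v; set z := iter n.+1 (delta a) v.
have z0 : z != 0 by apply/negP => /min_n; rewrite ltnn.
have az : cj a z = z by apply/eqP; rewrite -subr_eq0; apply/eqP.
have ay : cj a y = y + z by rewrite /z iterS /delta addrCA subrr addr0.
have Ky : rcos K q y by apply: rcos_delta.
have Kz : rcos K q z by apply: rcos_delta.
have [x Kx ax] : exists2 x, K x & cj a x = x + 1.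
  exists (y * z^-1); last by rewrite cjM // cjV // az ay mulrDl mulfVd.
  have -> : y * z^-1 = (y * q^-1) * (z * q^-1)^-1.
    by rewrite invMd ?invd_neq0 // invrK mulrA mulfVKd.
  by apply: divsubM => //; apply: divsubV.
pose fal := fix fal m := if m is m'.+1 then fal m' * (x - m'%:R) else 1.
have Kfal m : K (fal m).
  elim: m => [|m IH]; first exact: divsub1.
  by apply: divsubM => //; apply: divsubB => //; apply: divsub_nat.
have xfal m : x * fal m = fal m * x.
  elim: m => [|m IH] /=; first by rewrite mul1r mulr1.
  rewrite mulrA IH -!mulrA; congr (_ * _).
  by rewrite mulrBl mulrBr (commr_nat x m).
have afal m : cj a (fal m.+1) = (x + 1) * fal m.
  elim: m => [|m IH]; first by rewrite /= !(mul1r, mulr1) subr0.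
  rewrite [fal m.+2]/= -/(fal m.+1) cjM // IH -mulrA; congr (_ * _).
  have -> : cj a (x - m.+1%:R) = x - m%:R; last by [].
  rewrite cjB ax (_ : cj a m.+1%:R = m%:R + 1); last first.
    by rewrite natr1; apply/cj_id => //; exact: commr_nat.
  by rewrite opprD addrACA subrr addr0.
have dfal m : delta a (fal m.+1 * z) = fal m * z *+ m.+1.
  rewrite /delta cjM // afal az -mulrBl -mulrnAl; congr (_ * _).
  rewrite /= mulrDl mul1r mulrBr xfal opprB addrC addrA subrK.
  by rewrite mulr_natr mulrS addrC.
have dn m k : delta a (m *+ k) = delta a m *+ k.
  elim: k => [|k IH]; first by rewrite !mulr0n /delta cj0 subr0.
  rewrite !mulrS -IH -[m *+ k]opprK deltaB /delta cjN !opprK.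
  by rewrite opprD opprK.
have itn m k v' : iter m (delta a) (v' *+ k) = iter m (delta a) v' *+ k.
  by elim: m => [//|m IH]; rewrite !iterS IH dn.
have itfal m : iter m (delta a) (fal m * z) = z *+ m`!.
  elim: m => [|m IH]; first by rewrite mul1r.
  by rewrite iterSr dfal itn IH -mulrnA factS mulnC.
have := itfal r; rewrite nil; last first.
  by rewrite /rcos -mulrA; apply: divsubM.
move=> /esym/eqP; rewrite -mulr_natl; apply/negP/mulfd_neq0 => //.
by rewrite -(prednK (fact_gt0 r)); apply: natr_neq0_pchar0.
Qed.

End Unipotent.

(** An exponent which is 1 in characteristic 0, a power of [p] in
characteristic [p]. *)
Definition char_exponent n := n = 1%N \/
  exists p s, p \in [pchar D] /\ n = (p ^ s)%N.

(** If [cj a - 1] has nilpotency exponent [r] on [K q], then a power of [a] of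
exponent depending on [r] only commutes with [K] and [q]. *)
Lemma unipotent_exponent r : exists2 n, char_exponent n &
  forall K a q, divsub K -> K a -> a != 0 -> q != 0 ->
    (forall x, K x -> K (cj q x)) ->
    (forall v, rcos K q v -> iter r (delta a) v = 0) ->
    cent K (a ^+ n) /\ a ^+ n * q = q * a ^+ n.
Proof.
suff [n cn nP] : exists2 n, char_exponent n &
  forall K a q, divsub K -> K a -> a != 0 -> q != 0 ->
    (forall x, K x -> K (cj q x)) ->
    (forall v, rcos K q v -> iter r (delta a) v = 0) ->
    forall v, rcos K q v -> cj (a ^+ n) v = v.
  exists n => // K a q dK Ka a0 q0 nK nil.
  have com := nP _ _ _ dK Ka a0 q0 nK nil; have an0 := expd_neq0 n a0.
  have cq : cj (a ^+ n) q = q by apply: com; rewrite /rcos mulfVd //; apply: divsub1.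
  split; last exact/cj_id.
  move=> c Kc; apply/cj_id => //.
  have := com (c * q); rewrite /rcos mulfKd // cjM // cq => /(_ Kc).
  exact: mulId.
have [[p cp]|p0] := pselect (exists p, p \in [pchar D]).
  exists (p ^ r)%N; first by right; exists p, r.
  by move=> K a q dK Ka a0 q0 nK nil v Kv; apply: iter_delta_pchar => //; apply: nil.
exists 1%N; first by left.
move=> K a q dK Ka a0 q0 nK nil v Kv; rewrite expr1.
apply: (iter_delta_pchar0 dK Ka a0 q0 nK) nil _ Kv => p cp.
by apply: p0; exists p.
Qed.

End Words.

(** * Subnormal subgroups radical over the centre *)

Section Inseparable.
Variable D : divRing.
Implicit Types (x y z a b c g q v w : D) (H K G A B P Q M N S : set D).

(** The inner derivation of [a]. *)
Definition ad a v := a * v - v * a.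

(** [ad b] is evaluation at [b] of left multiplication by the polynomial
[b - X], whose [p]-th power is [b^p - X^p]. *)
Lemma iter_ad_pchar p b v : p \in [pchar D] ->
  iter p (ad b) v = b ^+ p * v - v * b ^+ p.
Proof.
move=> cp; have cP : p \in [pchar {poly D}] by rewrite pchar_poly.
have E n : iter n (ad b) v = ((b%:P - 'X) ^+ n * v%:P).[b].
  elim: n => [|n IH]; first by rewrite mul1r hornerC.
  rewrite iterS IH exprS -mulrA; set P := _ * v%:P.
  by rewrite mulrBl hornerD hornerN hornerCM -commr_polyX hornerMX.
rewrite E -(pFrobenius_autE cP) pFrobenius_autB_comm; last exact: commr_polyX.
rewrite !pFrobenius_autE mulrBl hornerD hornerN -rmorphXn /= -rmorphM hornerC.
by rewrite -commr_polyXn hornerCM hornerXn.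
Qed.

Lemma pchar_expB p x y n : p \in [pchar D] -> x * y = y * x ->
  (x - y) ^+ (p ^ n) = x ^+ (p ^ n) - y ^+ (p ^ n).
Proof.
move=> cp cxy; elim: n => [//|n IH].
rewrite expnSr !exprM IH -!(pFrobenius_autE cp) pFrobenius_autB_comm //.
exact/commrX/commr_sym/commrX/commr_sym.
Qed.

(** A subnormal subgroup which is purely inseparable over the centre is central.
For [b] in [M] whose [p]-th power, but not [b] itself, is central, there is [x]
with [cj b x = x + 1]. The iterated commutator [word b x r] has a central power
and commutes with its conjugate by [b], so it commutes with [b]; descending
along the word gives [cj b x = x]. *)
Lemma radical_subnorm_central A r M p s : divsub A -> p \in [pchar D] ->
  subnorm A r M -> (forall a, M a -> Zc A (a ^+ (p ^ s))) -> M `<=` cent A.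
Proof.
move=> dA cp sM radM a Ma; apply: contrapT => nca.
have gM := subnorm_mgroup dA sM; have sMA := subnorm_sub sM.
have [b [Mb ncb Zbp]] : exists b, [/\ M b, ~ cent A b & Zc A (b ^+ p)].
  have ex : exists i, `[< Zc A (a ^+ (p ^ i)) >] by exists s; apply/asboolP/radM.
  have [[|i] /asboolP Zi min_i] := ex_minnP ex.
    by case: nca; case: Zi; rewrite expr1.
  exists (a ^+ (p ^ i)); split; first exact: mgroupX.
    move=> c; have : `[< Zc A (a ^+ (p ^ i)) >].
      by apply/asboolP; split=> //; apply: (sMA _ (mgroupX gM _ Ma)).
    by move/min_i; rewrite ltnn.
  by rewrite -exprM -expnSr.
have b0 := mgroup_neq0 gM Mb; have Ab := sMA _ Mb.
have [x Ax bx] : exists2 x, A x & cj b x = x + 1.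
  have [v Av bv] : exists2 v, A v & ad b v <> 0.
    apply: contrapT => none; apply: ncb => v Av; apply/eqP.
    by rewrite -subr_eq0; apply/eqP; apply: contrapT => bv; apply: none; exists v.
  have Aad n : A (iter n (ad b) v).
    by elim: n => [//|n IH]; apply: divsubB => //; apply: divsubM.
  have adp : iter p (ad b) v = 0.
    by rewrite iter_ad_pchar //; case: Zbp => _ -> //; rewrite subrr.
  have ex : exists n, iter n (ad b) v == 0 by exists p; rewrite adp.
  have [[|[|n]] /eqP en min_n] := ex_minnP ex; [|by case: bv|].
    by case: bv; move: en => /= ->; rewrite /ad mulr0 mul0r subrr.
  set z := iter n.+1 (ad b) v in en; set x := iter n (ad b) v.
  have z0 : z != 0 by apply/negP => /min_n; rewrite ltnn.
  have bz : b * z = z * b by apply/eqP; rewrite -subr_eq0; apply/eqP.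
  have bz' : b * z^-1 = z^-1 * b by apply: commrV.
  exists (b * z^-1 * x).
    apply: (divsubM dA); last exact: Aad.
    by apply: (divsubM dA) => //; apply: (divsubV dA); apply: Aad.
  have e : b * x = z + x * b by rewrite /z iterS /ad subrK.
  have -> : cj b (b * z^-1 * x) = b * z^-1 * (b * x) * b^-1.
    by rewrite /cj !mulrA -[b * z^-1 * b]mulrA -bz' mulrA.
  by rewrite e mulrDr mulrDl mulfVKd // mulfVd // !mulrA mulfKd // addrC.
have x0 : x != 0.
  by apply: contraPneq bx => ->; rewrite cj0 add0r => /esym/eqP; rewrite oner_eq0.
pose B := cent (cent [set x]); have dB : divsub B by apply: divsub_cent.
have Bx : B x by move=> y /(_ x erefl).
have cB : B `<=` cent B by move=> y By z Bz; apply: By => _ ->; apply: Bz => _ ->.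
have sB y : B y -> B (cj b y).
  move=> By z cz; rewrite -[z](cjVK _ b0) -!cjM // By // => _ ->.
  apply: (can_inj (fun y => cjK y b0)); rewrite (cjM _ x b0) (cjM x _ b0) bx cjVK //.
  by rewrite mulrDr mulrDl mul1r mulr1 (cz x erefl).
have Bw n : B (word b x n).
  elim: n => [//|n IH]; rewrite /word iterS -/(word b x n).
  by apply: (divsubM dB); [exact: sB | exact: (divsubV dB)].
have Aw n : A (word b x n).
  elim: n => [//|n IH]; rewrite /word iterS -/(word b x n).
  by apply: (divsubM dA); [exact: divsub_cj | exact: (divsubV dA)].
have wr : word b x r.+1 = 1.
  have [Aws Cws] := radM _ (subnorm_word dA sM Mb Ax x0).
  set w := word b x r in Aws Cws.
  have e : cj b w ^+ (p ^ s) = w ^+ (p ^ s).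
    by rewrite -cjX //; apply/cj_id => //; rewrite Cws.
  have ew : cj b w - w = 0.
    apply: (@expd_eq0 _ _ (p ^ s)%N); rewrite pchar_expB ?e ?subrr //.
    by apply: cB; [apply: sB|]; apply: Bw.
  rewrite /word iterS -/(word b x r) -/w; move/eqP: ew; rewrite subr_eq0 => /eqP->.
  by rewrite mulfVd // word_neq0.
have {wr} : cj b x = x; last first.
  by rewrite bx => /eqP; rewrite -subr_eq0 addrC addKr oner_eq0.
elim: r {sM} wr => [|j IH].
  move=> /= e; rewrite -[LHS](mulfVKd _ x0) [X in X * _]e mul1r //.
set w := word b x j.+1 => e; apply: IH; rewrite -/w.
have w0 : w != 0 by apply: word_neq0.
have bw : cj b w = w.
  by rewrite -[LHS](mulfVKd _ w0) [X in X * _]e mul1r.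
set y := word b x j; have y0 : y != 0 by apply: word_neq0.
have by_ : cj b y = w * y by rewrite /w /word iterS -/(word b x j) mulfVKd.
have it n : iter n (cj b) y = w ^+ n * y.
  elim: n => [|n IH]; first by rewrite mul1r.
  by rewrite iterS IH cjM // cjX // bw by_ mulrA -exprSr.
have wp : w ^+ p = 1.
  apply: (mulId y0); rewrite mul1r -it iter_cj //.
  by apply/cj_id; [exact: expd_neq0 | case: Zbp => _ ->; last exact: Aw].
apply/eqP; rewrite -subr_eq0; apply/eqP; apply: (@expd_eq0 _ _ (p ^ 1)%N).
by rewrite pchar_expB ?mul1r ?mulr1 // expn1 wp expr1n subrr.
Qed.

End Inseparable.

(** * First order expansion of iterated commutators *)

Section Polynomials.
Variable D : divRing.
Implicit Types (x y z a b c e g q t u v w : D) (H K G A B P Q M N S : set D).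
Implicit Types (f h : {poly D}).

Lemma coef1M f h : (f * h)`_1 = f`_0 * h`_1 + f`_1 * h`_0.
Proof. by rewrite coefM big_ord_recl big_ord1. Qed.

(** The linear factor [1 + v X], and products of such factors. *)
Definition lin v : {poly D} := 1 + v%:P * 'X.

Lemma lin_coef0 v : (lin v)`_0 = 1.
Proof. by rewrite coefD coef1 coefMX addr0. Qed.

Lemma lin_coef1 v : (lin v)`_1 = v.
Proof. by rewrite coefD coef1 coefMX coefC add0r. Qed.

Lemma horner_lin v t : (lin v).[t] = 1 + v * t.
Proof. by rewrite hornerD hornerC hornerCM hornerX. Qed.

Definition lins (vs : seq D) : {poly D} := \prod_(v <- vs) lin v.

Lemma lins_coef0 vs : (lins vs)`_0 = 1.
Proof.
elim: vs => [|v vs IH]; first by rewrite /lins big_nil coef1.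
by rewrite /lins big_cons coef0M lin_coef0 mul1r.
Qed.

Section Graded.
Variables (K : set D) (q : D).
Hypotheses (dK : divsub K) (q0 : q != 0).
Hypothesis nK : forall x, K x -> K (cj q x).

(** Skew polynomials [\sum_i c_i q^i X^i] with [c_i] in [K]; the variable [X] of
[{poly D}] is central, and the twist is carried by the powers of [q]. *)
Definition skewpoly f := forall i, rcos K (q ^+ i) f`_i.

Lemma cjXK i x : K x -> K (cj (q ^+ i) x).
Proof.
move=> Kx; rewrite -iter_cj //; elim: i => [//|i IH].
by rewrite iterS; apply: nK.
Qed.

Lemma rcosM i j u v : rcos K (q ^+ i) u -> rcos K (q ^+ j) v ->
  rcos K (q ^+ (i + j)) (u * v).
Proof.
rewrite /rcos => Ku Kv.
have -> : u * v * (q ^+ (i + j))^-1 =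
    (u * (q ^+ i)^-1) * cj (q ^+ i) (v * (q ^+ j)^-1).
  by rewrite /cj exprD invMd ?expd_neq0 // !mulrA mulfVKd ?expd_neq0.
by apply: divsubM => //; apply: cjXK.
Qed.

Lemma rcosB i u v : rcos K (q ^+ i) u -> rcos K (q ^+ i) v ->
  rcos K (q ^+ i) (u - v).
Proof. by rewrite /rcos mulrBl; apply: divsubB. Qed.

Lemma rcos0 i : rcos K (q ^+ i) 0.
Proof. by rewrite /rcos mul0r; apply: divsub0. Qed.

Lemma skewB f h : skewpoly f -> skewpoly h -> skewpoly (f - h).
Proof. by move=> sf sh i; rewrite coefB; apply: rcosB. Qed.

Lemma skewD f h : skewpoly f -> skewpoly h -> skewpoly (f + h).
Proof.
move=> sf sh i; rewrite coefD /rcos mulrDl.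
by apply: (divsubD dK); [apply: sf | apply: sh].
Qed.

Lemma skewM f h : skewpoly f -> skewpoly h -> skewpoly (f * h).
Proof.
move=> sf sh i; rewrite coefM /rcos mulr_suml; apply: (divsub_sum dK) => j.
have := rcosM (sf j) (sh (i - j)%N).
by rewrite subnKC // -ltnS.
Qed.

Lemma skewC c : K c -> skewpoly c%:P.
Proof.
move=> Kc i; rewrite coefC; case: i => [|i]; last exact: rcos0.
by rewrite /rcos expr0 invr1 mulr1.
Qed.

Lemma skew_lin v : rcos K q v -> skewpoly (lin v).
Proof.
move=> Kv; apply: skewD; first by apply: skewC; apply: divsub1.
move=> i; rewrite coefMX; case: i => [|[|i]]; try exact: rcos0.
  by rewrite coefC.
by rewrite /= coefC; apply: rcos0.
Qed.

Lemma skew_lins vs : {in vs, forall v, rcos K q v} -> skewpoly (lins vs).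
Proof.
elim: vs => [|v vs IH] sv.
  by rewrite /lins big_nil; apply: skewC; apply: divsub1.
rewrite /lins big_cons; apply: skewM.
  by apply: skew_lin; apply: sv; apply: mem_head.
by apply: IH => w vw; apply: sv; rewrite inE vw orbT.
Qed.

(** Ore condition for one linear factor: right division of [f] by [lin v] leaves
a constant remainder, which has a common left multiple with [lin v] of the same
shape. *)
Lemma ore_lin f v : skewpoly f -> rcos K q v ->
  exists v' f', [/\ rcos K q v', skewpoly f' & lin v' * f = f' * lin v].
Proof.
move=> sf Kv; have [->|v0] := eqVneq v 0.
  exists 0, f; split=> //; first by rewrite /rcos mul0r; apply: divsub0.
  by rewrite /lin !mul0r !addr0 mul1r mulr1.
have [g [u efg]] : exists (g : {poly D}) (u : D), f = g * lin v + u%:P.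
  set x := - v^-1; have /factor_theorem[g eg] : root (f - f.[x]%:P) x.
    by rewrite /root hornerD hornerN hornerC subrr.
  exists (g * v^-1%:P), f.[x].
  rewrite -[LHS](subrK f.[x]%:P) eg -mulrA; congr (_ * _ + _).
  by rewrite mulrDr mulr1 mulrA -polyCM mulVd // mul1r /x polyCN opprK addrC.
have rec i : f`_i.+1 = g`_i.+1 + g`_i * v.
  rewrite efg coefD coefC addr0 mulrDr mulr1 coefD mulrA coefMX /=.
  by rewrite coefMC.
have sg : skewpoly g.
  suff H n i : (size g <= n + i)%N -> rcos K (q ^+ i) g`_i.
    by move=> i; apply: (H (size g)); apply: leq_addr.
  elim: n i => [|n IH] i; first by move=> ?; rewrite nth_default //; apply: rcos0.
  rewrite addSnnS => /IH Kg.
  have -> : g`_i = (f`_i.+1 - g`_i.+1) * v^-1 by rewrite rec addrC addKr mulfKd.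
  have := rcosB (sf i.+1) Kg; move: (_ - _) => w Kw.
  have Kqv : K (q * v^-1).
    have -> : q * v^-1 = (v * q^-1)^-1 by rewrite invMd ?invd_neq0 // invrK.
    exact: divsubV.
  rewrite /rcos.
  have -> : w * v^-1 * (q ^+ i)^-1 =
      w * (q ^+ i.+1)^-1 * cj (q ^+ i) (q * v^-1).
    by rewrite /cj [q ^+ i * _]mulrA -exprSr !mulrA mulfVKd ?expd_neq0.
  exact: (divsubM dK Kw (cjXK i Kqv)).
have Ku : K u.
  have := rcosB (sf 0%N) (sg 0%N); rewrite /rcos expr0 invr1 mulr1.
  by rewrite efg coefD coef0M lin_coef0 mulr1 coefC /= addrC addKr.
have [u0|u0] := eqVneq u 0.
  exists 0, g; split=> //; first by rewrite /rcos mul0r; apply: divsub0.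
  by rewrite /lin mul0r addr0 mul1r efg u0 addr0.
exists (cj u v), (lin (cj u v) * g + u%:P).
have Kv' : rcos K q (cj u v) by apply: rcos_cj.
split=> //.
  by apply: skewD; [apply: skewM => //; apply: skew_lin | apply: skewC].
rewrite {1}efg [LHS]mulrDr [RHS]mulrDl mulrA; congr (_ + _).
rewrite /lin mulrDl mul1r mulrDr mulr1 -mulrA -commr_polyX mulrA -!polyCM.
by rewrite /cj mulfVKd // mulrA -polyCM.
Qed.

(** A list of pairs of a sign and an element [v] stands for a product of factors
[(1 + v t)^(+-1)]: [ev] is the value of one factor at [t], [sg] its first order
coefficient, [evs] the value of the product, meaningful when the list is
[regular] at [t]. *)
Definition ev t (l : bool * D) := if l.1 then 1 + l.2 * t else (1 + l.2 * t)^-1.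
Definition sg (l : bool * D) := if l.1 then l.2 else - l.2.

Definition regular t (ls : seq (bool * D)) := {in ls, forall l, 1 + l.2 * t != 0}.
Definition evs t ls := \prod_(l <- ls) ev t l.

Lemma skew_comm f t : cent K t -> t * q = q * t -> skewpoly f -> comm_poly f t.
Proof.
move=> Kt qt sf; apply: comm_coef_poly => i.
rewrite -(mulfVKd f`_i (expd_neq0 i q0)); apply/commr_sym/commrM.
  exact: (Kt _ (sf i)).
exact: commrX.
Qed.

(** Ore condition for a product of linear factors. *)
Lemma ore_lins vs h : {in vs, forall v, rcos K q v} -> skewpoly h ->
  exists us h', [/\ {in us, forall u, rcos K q u}, skewpoly h' &
    lins us * h = h' * lins vs].
Proof.
elim/last_ind: vs h => [|vs v IH] h sv sh.
  by exists [::], h; split=> //; rewrite /lins !big_nil mul1r mulr1.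
have Kv : rcos K q v by apply: sv; rewrite mem_rcons mem_head.
have [u [h1 [Ku sh1 e1]]] := ore_lin sh Kv.
have [|us [h2 [Kus sh2 e2]]] := IH h1 _ sh1.
  by move=> w vw; apply: sv; rewrite mem_rcons inE vw orbT.
exists (rcons us u), h2; split=> //.
  by move=> w; rewrite mem_rcons inE => /orP[/eqP-> //|]; apply: Kus.
rewrite /lins !big_rcons /= -/(lins us) -/(lins vs).
by rewrite -mulrA e1 mulrA e2 mulrA.
Qed.

(** A product of factors [(1 + v t)^(+-1)] with [v] in [K q] is a left fraction
[S^-1 f] of skew polynomials, with [S] a
product of linear factors, and its first order coefficient is the difference of
those of [f] and [S]. *)
Lemma evs_fraction ls : {in ls, forall l, rcos K q l.2} ->
  exists vs f, [/\ {in vs, forall v, rcos K q v}, skewpoly f, f`_0 = 1,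
    f`_1 - (lins vs)`_1 = \sum_(l <- ls) sg l &
    forall t, cent K t -> t * q = q * t -> regular t ls ->
      (lins vs).[t] * evs t ls = f.[t]].
Proof.
elim/last_ind: ls => [|ls l IH] sl.
  exists [::], 1; split=> //; first by apply: skewC; apply: divsub1.
  - by rewrite coef1.
  - by rewrite /lins !big_nil coef1 subr0.
  - by move=> t _ _ _; rewrite /lins /evs !big_nil mulr1.
have Kl : rcos K q l.2 by apply: sl; rewrite mem_rcons mem_head.
have [|vs [f [sv sf f0 f1 ft]]] := IH.
  by move=> w lw; apply: sl; rewrite mem_rcons inE lw orbT.
have regI t : regular t (rcons ls l) -> regular t ls /\ 1 + l.2 * t != 0.
  move=> rl; split=> [w lw|]; apply: rl; rewrite mem_rcons ?mem_head //.
  by rewrite inE lw orbT.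
rewrite big_rcons /= /evs; case el : l.1.
  exists vs, (f * lin l.2); split=> //; first by apply: skewM => //; apply: skew_lin.
  - by rewrite coef0M f0 lin_coef0 mulr1.
  - rewrite coef1M f0 lin_coef0 lin_coef1 mul1r mulr1 -f1 /sg el.
    by rewrite addrC addrA addrAC.
  - move=> t Kt qt /regI[rt _]; rewrite big_rcons /= mulrA ft //.
    rewrite hornerM_comm; first by rewrite horner_lin /ev el.
    by apply: skew_comm => //; apply: skew_lin.
have [v' [f' [Kv' sf' e]]] := ore_lin sf Kl.
have f'0 : f'`_0 = 1.
  have := congr1 (fun p : {poly D} => p`_0) e.
  by rewrite /= !coef0M !lin_coef0 f0 !mulr1.
exists (v' :: vs), f'; split=> //.
- by move=> w; rewrite inE => /orP[/eqP->//|]; apply: sv.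
- have := congr1 (fun p : {poly D} => p`_1) e.
  rewrite /= !coef1M !lin_coef0 !lin_coef1 f0 f'0 !mul1r !mulr1 => e1.
  rewrite /lins big_cons -/(lins vs) coef1M lin_coef0 lin_coef1 lins_coef0.
  rewrite mul1r mulr1 -f1 /sg el.
  have -> : f'`_1 = f`_1 + v' - l.2 by rewrite e1 addrC addKr.
  by rewrite addrAC; congr (_ + _); rewrite opprD addrACA subrr addr0.
- move=> t Kt qt /regI[rt nz]; rewrite big_rcons /= /lins big_cons -/(lins vs).
  rewrite hornerM_comm; last by apply: skew_comm => //; apply: skew_lins.
  rewrite mulrA -[_ * _ * evs t ls]mulrA ft // /ev el.
  rewrite -hornerM_comm; last exact: skew_comm.
  rewrite e hornerM_comm; last by apply: skew_comm => //; apply: skew_lin.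
  by rewrite horner_lin mulfKd.
Qed.

End Graded.

(** The factorization of [word a (1 + v t) r]. *)
Fixpoint wordl a v r : seq (bool * D) :=
  if r is r'.+1 then [seq (l.1, cj a l.2) | l <- wordl a v r'] ++
    rev [seq (~~ l.1, l.2) | l <- wordl a v r'] else [:: (true, v)].

Section WordFactors.
Variables (a v t : D).
Hypotheses (a0 : a != 0) (at_ : a * t = t * a) (nz : 1 + v * t != 0).

Lemma evs_neq0 ls : regular t ls -> evs t ls != 0.
Proof.
elim: ls => [|l ls IH] rl; first by rewrite /evs big_nil oner_neq0.
rewrite /evs big_cons; apply: mulfd_neq0.
  have := rl l (mem_head _ _); rewrite /ev.
  by case: (l.1) => // nl; apply: invd_neq0.
by apply: IH => w lw; apply: rl; rewrite inE lw orbT.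
Qed.

Lemma wordl_regular r : regular t (wordl a v r).
Proof.
elim: r => [|r IH] l /=; first by rewrite inE => /eqP->.
rewrite mem_cat mem_rev => /orP[] /mapP[l' /IH nl' -> //=].
have -> : 1 + cj a l'.2 * t = cj a (1 + l'.2 * t); last exact: cj_neq0.
by rewrite cjD cj1 // cjM //; congr (_ + _ * _); apply/esym/cj_id.
Qed.

Lemma evs_wordl r : evs t (wordl a v r) = word a (1 + v * t) r.
Proof.
elim: r => [|r IH]; first by rewrite /evs /= big_seq1.
rewrite [wordl _ _ _]/= /word iterS -/(word a (1 + v * t) r) -IH /evs big_cat /=.
have reg := @wordl_regular r; congr (_ * _).
  rewrite big_map; elim: (wordl a v r) reg => [|l ls IHl] rl.
    by rewrite !big_nil cj1.
  rewrite !big_cons cjM // IHl; last by move=> w lw; apply: rl; rewrite inE lw orbT.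
  congr (_ * _); have nl := rl l (mem_head _ _).
  have e : 1 + cj a l.2 * t = cj a (1 + l.2 * t).
    by rewrite cjD cj1 // cjM //; congr (_ + _ * _); apply/esym/cj_id.
  by rewrite /ev /= e; case: (l.1) => //; rewrite cjV.
elim: (wordl a v r) reg => [|l ls IHl] rl; first by rewrite !big_nil invr1.
have nl := rl l (mem_head _ _).
have rls : regular t ls by move=> w lw; apply: rl; rewrite inE lw orbT.
have nls := evs_neq0 rls.
rewrite map_cons rev_cons big_rcons big_cons /= IHl // invMd //; last first.
  by rewrite /ev; case: (l.1); rewrite ?invd_neq0.
by congr (_ * _); rewrite /ev /=; case: (l.1); rewrite //= ?invrK.
Qed.

Lemma sg_wordl r : \sum_(l <- wordl a v r) sg l = iter r (delta a) v.
Proof.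
elim: r => [|r IH] /=; first by rewrite big_seq1.
rewrite big_cat /= -IH /delta; congr (_ + _).
  rewrite big_map; elim: (wordl a v r) => [|l ls IHl]; first by rewrite !big_nil cj0.
  by rewrite !big_cons cjD IHl /sg /=; case: (l.1); rewrite ?cjN.
rewrite (perm_big _ (permEl (perm_rev _))) /= big_map -sumrN.
by apply: eq_bigr => l _; rewrite /sg /=; case: (l.1); rewrite ?opprK.
Qed.

End WordFactors.

Lemma wordl_rcos K a q v r : divsub K -> K a -> a != 0 -> q != 0 ->
  (forall x, K x -> K (cj q x)) -> rcos K q v ->
  {in wordl a v r, forall l, rcos K q l.2}.
Proof.
move=> dK Ka a0 q0 nK Kv; elim: r => [|r IH] l /=; first by rewrite inE => /eqP->.
rewrite mem_cat mem_rev => /orP[] /mapP[l' /IH Kl' -> //=].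
exact: rcos_cj.
Qed.

(** Extraction of the first order coefficient when the powers of [q] are left
independent over [K]: one evaluation, at 1, suffices. *)
Lemma word_const_delta K a q v r : divsub K -> K a -> a != 0 -> q != 0 ->
  (forall x, K x -> K (cj q x)) ->
  (forall f, skewpoly K q f -> f.[1] = 0 -> f = 0) ->
  rcos K q v -> K (word a (1 + v) r) -> iter r (delta a) v = 0.
Proof.
move=> dK Ka a0 q0 nK ind Kv.
have nz : 1 + v * 1 != 0.
  apply/eqP; rewrite -horner_lin => l0.
  have /(congr1 (fun p : {poly D} => p`_0)) := ind _ (skew_lin dK Kv) l0.
  by rewrite /= lin_coef0 coef0 => /eqP; rewrite oner_eq0.
have com1 x : x * 1 = 1 * x by rewrite mulr1 mul1r.
have [vs [f [sv sf f0 f1 ft]]] :=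
  evs_fraction dK q0 nK (wordl_rcos dK Ka a0 q0 nK Kv (r := r)).
have := ft 1 (fun y _ => esym (com1 y)) (esym (com1 q))
  (wordl_regular a0 (com1 a) nz (r := r)).
rewrite evs_wordl // mulr1; set k := word _ _ _ => e Kk.
have {e} e : f = lins vs * k%:P.
  apply/eqP; rewrite -subr_eq0; apply/eqP/ind.
    apply: skewB => //; apply: skewM => //; first exact: skew_lins.
    exact: skewC.
  rewrite hornerD hornerN -e hornerM_comm; last by rewrite /comm_poly com1.
  by rewrite hornerC subrr.
have k1 : k = 1.
  have := congr1 (fun p : {poly D} => p`_0) e.
  by rewrite /= f0 coef0M lins_coef0 coefC mul1r.
have := f1; rewrite e k1 mulr1 subrr sg_wordl //.
Qed.

(** Extraction of the first order coefficient by evaluation at infinitely many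
central elements. *)
Lemma word_comm_delta A a v e r : divsub A -> A a -> a != 0 -> A v -> A e ->
  infinite_set (Zc A) ->
  (forall t, Zc A t -> 1 + v * t != 0 -> cent [set e] (word a (1 + v * t) r)) ->
  cent [set e] (iter r (delta a) v).
Proof.
move=> dA Aa a0 Av Ae infZ cw; have q0 := oner_neq0 D.
have nK x : A x -> A (cj 1 x) by rewrite /cj mul1r invr1 mulr1.
have rA x : A x -> rcos A 1 x by rewrite /rcos invr1 mulr1.
have dZ := divsub_Zc dA.
have [vs [f [sv sf f0 f1 ft]]] :=
  evs_fraction dA q0 nK (wordl_rcos dA Aa a0 q0 nK (rA _ Av) (r := r)).
have sS := skew_lins dA q0 nK sv; have se := skewC 1 dA Ae.
(* A second use of the Ore condition expresses that [S^-1 f] commutes with [e] as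
an identity between polynomials. *)
have [us [h [su sh eh]]] := ore_lins dA q0 nK sv (skewM dA q0 nK sS se).
have sT := skew_lins dA q0 nK su.
have hM t (g1 g2 : {poly D}) : Zc A t -> skewpoly A 1 g2 ->
    (g1 * g2).[t] = g1.[t] * g2.[t].
  move=> [_ At] sg2; apply: hornerM_comm; apply: (skew_comm q0 At) => //.
  by rewrite mul1r mulr1.
pose p := lins us * f * e%:P - h * f.
have p0 : p = 0.
  apply: contrapT => /eqP np.
  have cZ : Zc A `<=` cent (Zc A) by move=> x [_ cx] y [Ay _]; apply: cx.
  have fin : finite_set ([set x | Zc A x /\ root p x] `|` [set - v^-1]).
    by rewrite finite_setU; split; [exact: finite_roots | exact: finite_set1].
  apply: infZ; apply: sub_finite_set fin => t Zt.
  have [nz|nz] := eqVneq (1 + v * t) 0; [right|left].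
    have v0 : v != 0.
      by apply: contra_eq_neq nz => ->; rewrite mul0r addr0 oner_neq0.
    apply: (mulLd v0); rewrite mulrN mulfVd //; apply/eqP.
    by rewrite -addr_eq0 addrC nz.
  split=> //; have at_ : a * t = t * a by case: (Zt) => _ ->.
  have := ft t _ _ (wordl_regular a0 at_ nz (r := r)).
  rewrite evs_wordl //; set k := word _ _ _ => ek.
  have {}ek : (lins vs).[t] * k = f.[t].
    by apply: ek; [case: Zt | rewrite mul1r mulr1].
  have ke : k * e = e * k by apply: cw.
  have he : (lins us * (lins vs * e%:P)).[t] = (h * lins vs).[t] by rewrite eh.
  rewrite !hM ?hornerC // in he; last exact: skewM.
  rewrite /root /p hornerD hornerN !hM // hornerC -ek -mulrA subr_eq0.
  by rewrite -[_ * k * e]mulrA ke !mulrA -[_ * _ * e]mulrA he.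
have h0 : h`_0 = e.
  have := congr1 (fun g : {poly D} => g`_0) p0.
  rewrite /p /= coefB !coef0M coefC !lins_coef0 f0 coef0 !mul1r mulr1.
  by move/eqP; rewrite subr_eq0 => /eqP.
have e1 := congr1 (fun g : {poly D} => g`_1) p0.
have e2 := congr1 (fun g : {poly D} => g`_1) eh.
rewrite /= coefB coefMC !coef1M h0 f0 lins_coef0 mul1r mulr1 coef0 in e1.
rewrite /= [LHS]coef1M [RHS]coef1M !coefMC h0 !lins_coef0 !mul1r mulr1 in e2.
move=> _ ->; rewrite -sg_wordl // -f1.
move/eqP: e1; rewrite subr_eq0 => /eqP e1.
rewrite mulrDl mulr1 in e1; have := congr2 (fun x y => x - y) e1 e2.
by rewrite !opprD [LHS]addrACA [RHS]addrACA !subrr !addr0 mulrBl mulrBr.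
Qed.

End Polynomials.

(** * Centralizers of subnormal subgroups: infinite centre *)

Section InfiniteCentre.
Variable D : divRing.
Implicit Types (x y z a b c e g q t u v w : D) (H K G A B E P Q M N S : set D).

Lemma char_exponent_central A r M n : divsub A -> subnorm A r M ->
  char_exponent D n -> (forall a, M a -> Zc A (a ^+ n)) -> M `<=` cent A.
Proof.
move=> dA sM [->|[p [s [cp ->]]]] Zn.
  by move=> a /Zn; rewrite expr1 => -[].
exact: radical_subnorm_central cp sM Zn.
Qed.

(** If, for all [a] in [M] and [q] in [Q] outside [K], the operator [cj a - 1]
is nilpotent on [K q] with a uniform exponent, then [M] is central. *)
Lemma nilpotent_delta_central A K M Q r s : divsub A -> divsub K ->
  subnorm A s M -> mgroup Q -> Q `<=` A -> normed Q K -> M `<=` K ->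
  (exists2 q, Q q & ~ K q) ->
  (forall x, A x -> cent Q x -> cent A x) ->
  (forall a q v, M a -> Q q -> ~ K q -> rcos K q v -> iter r (delta a) v = 0) ->
  M `<=` cent A.
Proof.
move=> dA dK sM gQ sQA nQK sMK [q0 Qq0 Kq0] cQ nil.
have gM := subnorm_mgroup dA sM; have [n cn nP] := unipotent_exponent D r.
apply: (char_exponent_central dA sM cn) => a Ma.
have Aan : A (a ^+ n) by exact: (subnorm_sub sM (mgroupX gM n Ma)).
have fact q : Q q -> ~ K q -> cent K (a ^+ n) /\ a ^+ n * q = q * a ^+ n.
  move=> Qq Kq; apply: (nP _ _ _ dK) => //; first exact: sMK.
  - exact: mgroup_neq0 Ma.
  - exact: mgroup_neq0 Qq.
  - by move=> x; apply: nQK.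
  - by move=> v; apply: nil.
split=> //; apply: cQ => // x Qx; have [Kx|Kx] := pselect (K x).
  by have [cK _] := fact _ Qq0 Kq0; apply: cK.
by have [_] := fact _ Qx Kx.
Qed.

(** With [E] the centralizer of [M] and [K] that of [E], the factor [1 + v t]
runs over infinitely many [t] for every [v] in [K q], [q] in [Q] outside [K];
the first order coefficient of [word a (1 + v t)] commutes with [E] and lies in
[K q], so it vanishes. *)
Theorem trivial_centralizers_infinite A : divsub A -> infinite_set (Zc A) ->
  trivial_centralizers A.
Proof.
move=> dA infZ; elim=> [|r IH] M k.
  move=> -> Ak ck; right=> x Ax; have [->|x0] := eqVneq x 0.
    by rewrite mulr0 mul0r.
  exact: ck.
move=> sM Ak ck; have [gM [Q [sQ sMQ nQM]]] := sM.
apply: contrapT => /not_orP[ncM nck].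
have gQ := subnorm_mgroup dA sQ; have sQA := subnorm_sub sQ.
have sMA : M `<=` A by apply: subset_trans sQA.
have cQ x : A x -> cent Q x -> cent A x.
  by move=> Ax /(IH _ _ sQ Ax)[cQ|//]; case: ncM => y /sMQ /cQ.
have nQA : normed Q A by move=> x y /sQA; apply: divsub_cj.
pose E := cent M `&` A; pose K := cent E `&` A.
have nQE : normed Q E by apply: normedI => //; apply: normed_cent.
have nQK : normed Q K by apply: normedI => //; apply: normed_cent.
have dK : divsub K by apply: divsubI => //; apply: divsub_cent.
have sMK : M `<=` K.
  by move=> x Mx; split; [move=> y [cy _]; rewrite cy | apply: sMA].
apply: ncM.
apply: (nilpotent_delta_central dA dK sM gQ sQA nQK sMK (r := r.+1)) => //.
  apply: contrapT => none; apply/nck/cQ => // q Qq.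
  have [cE _] : K q by apply: contrapT => Kq; apply: none; exists q.
  by rewrite cE //; split.
move=> a q v Ma Qq Kq Kv; have a0 := mgroup_neq0 gM Ma.
have q0 := mgroup_neq0 gQ Qq; have Aa := sMA _ Ma.
have Av : A v.
  by rewrite -(mulfVKd v q0); apply: (divsubM dA); [case: Kv | apply: sQA].
have [e [ce Ae] nqe] : exists2 e, E e & q * e <> e * q.
  apply: contrapT => none; apply: Kq; split; last exact: sQA.
  by move=> e Ee; apply: contrapT => ne; apply: none; exists e.
have de : iter r.+1 (delta a) v * e = e * iter r.+1 (delta a) v.
  apply: (word_comm_delta dA Aa a0 Av Ae infZ) => // t [At ct] nz _ ->.
  rewrite ce //; apply: (subnorm_word dA sM Ma) => //.
  apply: (divsubD dA); first exact: divsub1.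
  exact: divsubM.
have [cd Ad] : rcos K q (iter r.+1 (delta a) v).
  by apply: rcos_delta => //; [apply: sMK | move=> x; apply: nQK].
move: de cd; set d := iter _ _ _ => de cd; apply: contrapT => /eqP d0.
apply: nqe; apply: (@mulLd _ _ _ (d * q^-1)).
  by apply: mulfd_neq0 => //; apply: invd_neq0.
have Ee : E e by [].
by rewrite [LHS]mulrA mulfVKd // de [RHS]mulrA (cd e Ee) -mulrA mulfVKd.
Qed.

End InfiniteCentre.

(** * Finite subrings and torsion elements *)

Section FiniteSubrings.
Variable D : divRing.
Implicit Types (x y z a b c e g q t u v w : D) (H K G A B E L P Q M N R S : set D).

Lemma finite_repeat S (g : nat -> D) : finite_set S -> (forall i, S (g i)) ->
  exists i j, (i < j)%N /\ g i = g j.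
Proof.
move=> /finite_seqP[s ->] sg.
pose h (i : 'I_(size s).+1) : 'I_(size s) :=
  Ordinal (etrans (index_mem (g i) s) (sg i)).
have /injectivePn[i [j nij hij]] : ~~ injectiveb h.
  by apply/negP => /injectiveP/leq_card; rewrite !card_ord ltnn.
have e : g i = g j.
  have hv : index (g i) s = index (g j) s := congr1 val hij.
  by rewrite -(nth_index 0 (sg i)) hv nth_index //; apply: sg.
have [ij|ji|eij] := ltngtP i j; first by exists i, j.
  by exists j, i.
by rewrite (val_inj eij) eqxx in nij.
Qed.

Lemma finite_torsion S x : finite_set S -> x != 0 -> (forall i, S (x ^+ i)) ->
  exists2 m, (0 < m)%N & x ^+ m = 1.
Proof.
move=> finS x0 /(finite_repeat finS)[i [j [ij e]]].
exists (j - i)%N; first by rewrite subn_gt0.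
apply: (mulLd (expd_neq0 i x0)); rewrite -exprD subnKC ?mulr1 //.
exact: ltnW.
Qed.

(** Unital subrings, as sets. *)
Definition subring S := [/\ S 1, forall x y, S x -> S y -> S (x - y) &
  forall x y, S x -> S y -> S (x * y)].

Lemma subringX S x n : subring S -> S x -> S (x ^+ n).
Proof.
move=> [S1 _ SM] Sx; elim: n => [//|n IH].
by rewrite exprS; apply: (SM).
Qed.

Lemma subringD S x y : subring S -> S x -> S y -> S (x + y).
Proof.
move=> [S1 SB _] Sx Sy; rewrite -(opprK y) -[- y]sub0r; apply: (SB) => //.
by apply: (SB) => //; rewrite -(subrr 1); apply: (SB).
Qed.

Lemma finite_subring_comm S : subring S -> finite_set S ->
  forall x y, S x -> S y -> x * y = y * x.
Proof.
move=> rS finS; have [S1 SB SM] := rS.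
apply: wedderburn => //; split=> //.
move=> x Sx; have [->|x0] := eqVneq x 0.
  by rewrite invr0 -(subrr 1); apply: (SB).
have [[//|m] _ e] := finite_torsion finS x0 (fun i => subringX i rS Sx).
have -> : x^-1 = x ^+ m by apply: (mulLd x0); rewrite mulfVd // -exprS.
exact: subringX.
Qed.

(** A finite subring and a torsion element normalizing it generate a finite
subring, the span of the powers of the element. *)
Lemma finite_extension L u m : subring L -> finite_set L -> u != 0 ->
  (0 < m)%N -> u ^+ m = 1 -> (forall x, L x -> L (cj u x)) ->
  exists S, [/\ subring S, finite_set S, L `<=` S, S u &
    forall R, subring R -> L `<=` R -> R u -> S `<=` R].
Proof.
move=> rL finL u0 m0 um nL; have [L1 LB LM] := rL.
have L0 : L 0 by rewrite -(subrr 1); apply: (LB).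
have LD x y : L x -> L y -> L (x + y) by apply: subringD.
pose S : set D := [set x | exists2 l : 'I_m -> D, forall i, L (l i) &
  x = \sum_i l i * u ^+ i].
have SB x y : S x -> S y -> S (x - y).
  move=> [l Ll ->] [k Lk ->]; exists (fun i => l i - k i) => [i|].
    exact: LB.
  by rewrite -sumrB; apply: eq_bigr => i _; rewrite mulrBl.
have S0 : S 0.
  by exists (fun=> 0) => //; rewrite big1 // => i _; rewrite mul0r.
have SD x y : S x -> S y -> S (x + y).
  by move=> Sx Sy; rewrite -(opprK y) -[- y]sub0r; apply/SB/SB.
have Slu l n : L l -> S (l * u ^+ n).
  move=> Ll; have nm : (n %% m < m)%N by rewrite ltn_mod.
  exists (fun i => if i == Ordinal nm then l else 0) => [i|].
    by case: ifP.
  rewrite (bigD1 (Ordinal nm)) //= eqxx big1 ?addr0 => [|i /negPf->].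
    by rewrite {1}(divn_eq n m) exprD mulnC exprM um expr1n mul1r.
  by rewrite mul0r.
have Ssum (F : 'I_m -> D) : (forall i, S (F i)) -> S (\sum_i F i).
  by move=> SF; apply: big_ind.
have cjL i x : L x -> L (cj (u ^+ i) x).
  move=> Lx; rewrite -iter_cj //; elim: i => [//|i IH].
  by rewrite iterS; apply: nL.
exists S; split.
- split=> //; first by rewrite -[1]mul1r -(expr0 u); apply: (Slu).
  move=> x y [l Ll ->] [k Lk ->]; rewrite mulr_suml; apply: (Ssum) => i.
  rewrite mulr_sumr; apply: (Ssum) => j.
  have -> : l i * u ^+ i * (k j * u ^+ j) =
      (l i * cj (u ^+ i) (k j)) * u ^+ (i + j).
    by rewrite exprD /cj !mulrA mulfVKd ?expd_neq0.
  by apply: (Slu); apply: (LM) => //; apply: (cjL).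
- have /finite_seqP[s es] := finL.
  have : finite_set [set \sum_i s`_(f i) * u ^+ i |
      f in [set: {ffun 'I_m -> 'I_(size s)}]].
    by apply: finite_image; apply: finite_finset.
  apply: sub_finite_set => _ [l Ll ->].
  have sl i : l i \in s by have := Ll i; rewrite es.
  exists [ffun i => Ordinal (etrans (index_mem (l i) s) (sl i))] => //.
  by apply: eq_bigr => i _; rewrite ffunE /= nth_index.
- by move=> x Lx; rewrite -[x]mulr1 -(expr0 u); apply: (Slu).
- by rewrite -[u]mul1r -[X in _ * X]expr1; apply: (Slu).
- move=> R rR LR Ru _ [l Ll ->]; have [R1 RB RM] := rR.
  apply: big_ind => [||i _]; first by rewrite -(subrr 1); apply: (RB).
    by move=> x y; apply: subringD.
  by apply: (RM); [apply: LR | apply: subringX].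
Qed.

(** By Wedderburn's theorem. *)
Lemma finite_normal_comm L u m x : subring L -> finite_set L -> u != 0 ->
  (0 < m)%N -> u ^+ m = 1 -> (forall x, L x -> L (cj u x)) -> L x ->
  u * x = x * u.
Proof.
move=> rL finL u0 m0 um nL Lx.
have [S [rS finS LS Su _]] := finite_extension rL finL u0 m0 um nL.
by apply: (finite_subring_comm rS finS) => //; apply: LS.
Qed.

Lemma prime_subring p : p \in [pchar D] -> exists L,
  [/\ subring L, finite_set L & forall x, L x -> exists n : nat, x = n%:R].
Proof.
move=> cp; have p0 : (0 < p)%N by case/andP: cp => /prime_gt0.
exists [set x : D | exists n : nat, x = n%:R]; split=> //.
- split; first by exists 1%N.
    move=> _ _ [n ->] [m ->]; exists (n + m * p.-1)%N.
    rewrite natrD; congr (_ + _); apply/eqP; rewrite eq_sym -addr_eq0 -natrD.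
    by rewrite -mulnSr prednK // natrM (pcharf0 cp) mulr0.
  by move=> _ _ [n ->] [m ->]; exists (n * m)%N; rewrite natrM.
- have : finite_set [set (i%:R : D) | i in [set: 'I_p]].
    by apply: finite_image; apply: finite_finset.
  apply: sub_finite_set => _ [n ->].
  have np : (n %% p < p)%N by rewrite ltn_mod.
  by exists (Ordinal np) => //=; rewrite (GRing.natr_mod_pchar cp).
Qed.

(** A torsion element has order prime to the characteristic. *)
Lemma torsion_order p e m : p \in [pchar D] -> (0 < m)%N -> e ^+ m = 1 ->
  exists n, [/\ (0 < n)%N, e ^+ n = 1, (n%:R : D) != 0 &
    forall j, (0 < j < n)%N -> e ^+ j != 1].
Proof.
move=> cp m0 em; have ex : exists n, (0 < n)%N && (e ^+ n == 1).
  by exists m; rewrite m0 em eqxx.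
have [n /andP[n0 /eqP en] min_n] := ex_minnP ex.
exists n; split=> //; last first.
  move=> j /andP[j0 jn]; apply/negP => ej.
  by have := min_n j; rewrite j0 ej leqNgt jn => /(_ isT).
apply/negP; rewrite -(dvdn_pcharf cp) => /dvdnP[k ek].
have p1 : (1 < p)%N by case/andP: cp => /prime_gt1.
have k0 : (0 < k)%N by case: k ek n0 => // ->.
have ek1 : e ^+ k = 1.
  apply/eqP; rewrite -subr_eq0; apply/eqP/(@expd_eq0 _ _ (p ^ 1)%N).
  by rewrite pchar_expB ?mul1r ?mulr1 // expn1 expr1n -exprM -ek en subrr.
have := min_n k; rewrite k0 ek1 eqxx => /(_ isT).
by rewrite ek leqNgt ltn_Pmulr.
Qed.

(** A division subring of torsion elements is commutative in characteristic [p].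
The conjugation by a torsion element [e] has eigenvalues which are powers of
[e], the eigenvectors being the Lagrange resolvents of an element [v]; an
eigenvector [u] for a nontrivial one normalizes the finite
subring generated by [e]. *)
Lemma torsion_comm p E : p \in [pchar D] -> divsub E ->
  (forall e, E e -> e != 0 -> exists2 m, (0 < m)%N & e ^+ m = 1) ->
  E `<=` cent E.
Proof.
move=> cp dE torE e Ee v Ev; have [->|e0] := eqVneq e 0.
  by rewrite mulr0 mul0r.
apply: contrapT => nev; have [m m0 em] := torE e Ee e0.
have [n' [n0 en nR ord_e]] := torsion_order cp m0 em.
case: n' n0 en nR ord_e => // n n0 en nR ord_e.
pose w := e^-1; have w0 : w != 0 by apply: invd_neq0.
have ew : e * w = w * e by rewrite mulfVd // mulVd.
have cjw k : cj e (w ^+ k) = w ^+ k by apply/cj_id => //; apply: commrX.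
have wn : w ^+ n.+1 = 1 by rewrite exprVn en invr1.
(* The Lagrange resolvents [r i], with [cj e (r i) = e ^+ i * r i]. *)
pose F i j := w ^+ (i * j) * iter j (cj e) v.
pose r i := \sum_(j < n.+1) F i j.
have cjr i : w ^+ i * cj e (r i) = r i.
  have cj_sum (I : Type) (s : seq I) (G : I -> D) :
      cj e (\sum_(k <- s) G k) = \sum_(k <- s) cj e (G k).
    by apply: (big_morph (cj e)) => [x y|]; [exact: cjD | exact: cj0].
  have FS j : w ^+ i * cj e (F i j) = F i j.+1.
    by rewrite /F cjM // cjw mulrA -exprD iterS mulnS.
  have Fn : F i n.+1 = F i 0%N.
    by rewrite /F iter_cj // en mulnC exprM wn expr1n muln0 /cj invr1 !mulr1 !mul1r.
  rewrite /r cj_sum mulr_sumr (eq_bigr (fun j : 'I_n.+1 => F i j.+1)).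
    2: by move=> j _; exact: FS.
  by rewrite big_ord_recr [RHS]big_ord_recl /= Fn addrC.
have sum_r : \sum_(i < n.+1) r i = v *+ n.+1.
  rewrite exchange_big /=.
  rewrite big_ord_recl [X in _ + X]big1 => [|j _]; last first.
    rewrite -mulr_suml; set g := w ^+ (lift ord0 j).
    have -> : \sum_(i < n.+1) w ^+ (i * lift ord0 j) = \sum_(i < n.+1) g ^+ i.
      by apply: eq_bigr => i _; rewrite mulnC exprM.
    have g1 : g - 1 != 0.
      rewrite subr_eq0 /g exprVn; apply: contraNneq (ord_e (lift ord0 j) _).
        by move=> /(congr1 GRing.inv); rewrite invrK invr1 => ->.
      by rewrite lift0 /= ltnS ltn_ord.
    have := subrX1 g n.+1; rewrite -exprM mulnC exprM wn expr1n subrr.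
    by move/esym/mulfd_eq0 => [e1|->]; [rewrite e1 eqxx in g1 | rewrite mul0r].
  rewrite addr0 (eq_bigr (fun=> v)) ?sumr_const ?card_ord // => i _.
  by rewrite /F /= muln0 mul1r.
have Er i : E (r i).
  apply: (divsub_sum dE) => j; apply: (divsubM dE).
    by apply: (divsubX dE); apply: (divsubV dE).
  by rewrite iter_cj //; apply: (divsub_cj dE) => //; apply: (divsubX dE).
have cje i : cj e (r i) = e ^+ i * r i.
  by rewrite -[in RHS](cjr i) mulrA -exprMn_comm // /w mulfVd // expr1n mul1r.
have [i [i0 ni ri]] : exists i, [/\ (0 < i)%N, (i < n.+1)%N & r i != 0].
  apply: contrapT => none; apply: nev; apply/esym/esym.
  have rv : r 0%N = v *+ n.+1.
    rewrite -sum_r big_ord_recl big1 ?addr0 // => j _; apply/eqP/negPn/negP => nz.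
    by apply: none; exists (lift ord0 j); split=> //; apply: ltn_ord.
  have cjn : cj e n.+1%:R = n.+1%:R by apply/cj_id => //; apply: commr_nat.
  have := cje 0%N; rewrite mul1r rv -mulr_natr cjM // cjn.
  by move/(mulId nR)/cj_id; apply.
have [L0 [rL0 finL0 natL0]] := prime_subring cp.
have [|L [rL finL L0L Le minL]] := finite_extension rL0 finL0 e0 n0 en.
  move=> x /[dup] Lx /natL0[k ek]; rewrite (_ : cj e x = x) //.
  by apply/cj_id => //; rewrite ek; apply: commr_nat.
have [k k0 rk] := torE _ (Er i) ri.
have [L1 LB LM] := rL.
have ue : r i * e = e * r i.
  apply: (finite_normal_comm rL finL ri k0 rk) => //.
  apply: (minL [set x | L (cj (r i) x)]).
  - split=> /=; first by rewrite cj1.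
      by move=> x y Lx Ly; rewrite cjB; apply: (LB).
    by move=> x y Lx Ly; rewrite cjM //; apply: (LM).
  - move=> x /= /[dup] Lx /natL0[l el]; rewrite (_ : cj (r i) x = x).
      exact: L0L.
    by apply/cj_id => //; rewrite el; apply: commr_nat.
  - rewrite /=.
    have -> : cj (r i) e = w ^+ i * e.
      apply: (mulId ri); rewrite /cj mulfVKd //.
      have we : w ^+ i * e ^+ i = 1 by rewrite -exprMn_comm // mulVd // expr1n.
      by rewrite -mulrA (cj_swap _ e0) cje !mulrA we mul1r.
    apply: (LM) => //.
    have -> : w = e ^+ n by apply: (mulLd e0); rewrite mulfVd // -exprS.
    by rewrite -exprM; apply: subringX.
have := ord_e i; rewrite i0 ni => /(_ isT)/eqP; apply.
by apply: (mulId ri); rewrite -cje mul1r; apply/cj_id.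
Qed.

End FiniteSubrings.

(** * Independence of powers over a division subring *)

Section FieldCase.
Variable D : divRing.
Implicit Types (x y z a b c e q t u v w : D) (H K G A B E L P Q M N R S : set D).
Implicit Types (f g h : {poly D}).

Lemma horner1M f g : (f * g).[1] = f.[1] * g.[1].
Proof. by apply: hornerM_comm; rewrite /comm_poly mulr1 mul1r. Qed.

(** A monic left dependence relation of minimal length between the powers of
[q] has coefficients commuting with [K], up to a power of [q]. *)
Lemma skew_dependence K q f : divsub K -> q != 0 ->
  (forall x, K x -> K (cj q x)) -> (forall x, K x -> K (cj q^-1 x)) ->
  skewpoly K q f -> f.[1] = 0 -> f <> 0 ->
  exists m g, [/\ size g = m.+1, skewpoly K q g, g`_m = q ^+ m, g.[1] = 0 &
    forall i, cent K (g`_i * (q ^+ m)^-1)].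
Proof.
move=> dK q0 nK nK' sf f1 f0.
pose dep n := exists g, [/\ skewpoly K q g, g.[1] = 0, g != 0 & size g = n].
have ex : exists n, `[< dep n >].
  by exists (size f); apply/asboolP; exists f; split=> //; apply/eqP.
have [[|m] /asboolP[g0 [sg0 g01 nz0 szg0]] min_m] := ex_minnP ex.
  by move/eqP: szg0; rewrite size_poly_eq0 (negPf nz0).
have lead0 : g0`_m != 0.
  by have := nz0; rewrite -lead_coef_eq0 lead_coefE szg0.
pose c := q ^+ m * (g0`_m)^-1.
have Kc : K c.
  have -> : c = (g0`_m * (q ^+ m)^-1)^-1.
    by rewrite invMd ?invd_neq0 ?expd_neq0 // invrK.
  by apply: divsubV dK _ (sg0 m).
have c0 : c != 0 by rewrite mulfd_neq0 ?expd_neq0 ?invd_neq0.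
pose g := c%:P * g0.
have gi i : g`_i = c * g0`_i by rewrite coefCM.
have sg : skewpoly K q g by apply: skewM => //; apply: skewC.
have gm : g`_m = q ^+ m by rewrite gi mulfVKd.
have szg : (size g <= m.+1)%N.
  by apply/leq_sizeP => i im; rewrite gi nth_default ?mulr0 // szg0.
have g1 : g.[1] = 0 by rewrite horner1M g01 mulr0.
exists m, g; split=> //.
  apply/eqP; rewrite eqn_leq szg ltnNge; apply/negP => /leq_sizeP/(_ m (leqnn m)).
  by rewrite gm; apply/eqP/expd_neq0.
move=> i k Kk; have qm0 := expd_neq0 m q0.
pose k' := cj (q ^+ m)^-1 k.
have Kk' : K k'.
  rewrite /k' -exprVn -iter_cj ?invd_neq0 //.
  by elim: (m) => [//|n IH]; rewrite iterS; apply: nK'.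
have e : k%:P * g - g * k'%:P = 0.
  apply/eqP/negPn/negP => nz; set h := _ - _ in nz.
  have szh : (size h <= m)%N.
    apply/leq_sizeP => j; rewrite leq_eqVlt => /orP[/eqP<-|mj].
      by rewrite coefB coefCM coefMC gm (cj_swap _ qm0) cjVK // subrr.
    by rewrite coefB coefCM coefMC gi nth_default ?szg0 // !(mulr0, mul0r) subrr.
  have : `[< dep (size h) >].
    apply/asboolP; exists h; split=> //.
      by apply: skewB => //; apply: skewM => //; apply: skewC.
    rewrite /h hornerD hornerN (horner1M _ g) (horner1M g) g1.
    by rewrite !(mulr0, mul0r) subrr.
  by move/min_m; rewrite ltnNge szh.
have := congr1 (fun h : {poly D} => h`_i) e.
rewrite /= coefB coefCM coefMC coef0 => /eqP; rewrite subr_eq0 => /eqP ei.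
by rewrite [RHS]mulrA ei /k' /cj invrK !mulrA mulfKd.
Qed.

(** If no power of [q] lies in [K], a subring containing its centralizer, then
the powers of [q] are independent. *)
Lemma skew_independence_field K q : divsub K -> q != 0 ->
  (forall x, K x -> K (cj q x)) -> (forall x, K x -> K (cj q^-1 x)) ->
  cent K `<=` K -> (forall n, (0 < n)%N -> ~ K (q ^+ n)) ->
  forall f, skewpoly K q f -> f.[1] = 0 -> f = 0.
Proof.
move=> dK q0 nK nK' sK nq f sf f1; apply: contrapT => f0.
have [m [g [szg sg gm g1 cg]]] := skew_dependence dK q0 nK nK' sf f1 f0.
have [i [im gi]] : exists i, (i < m)%N /\ g`_i != 0.
  apply: contrapT => none; have := g1.
  rewrite horner_coef szg big_ord_recr big1 /= => [|i _].
    by rewrite add0r gm expr1n mulr1; apply/eqP/expd_neq0.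
  rewrite expr1n mulr1; apply/eqP/negPn/negP => gi; apply: none.
  by exists i; split.
apply: (nq (m - i)%N); first by rewrite subn_gt0.
pose d := g`_i * (q ^+ i)^-1; have Kd : K d := sg i.
have d0 : d != 0 by rewrite mulfd_neq0 ?invd_neq0 ?expd_neq0.
have -> : q ^+ (m - i) = (g`_i * (q ^+ m)^-1)^-1 * d.
  rewrite invMd ?invd_neq0 ?expd_neq0 // invrK /d mulrA mulfVKd //.
  by rewrite -[in RHS](subnK (ltnW im)) exprD mulfKd ?expd_neq0.
by apply: (divsubM dK) => //; apply: (divsubV dK); apply: sK.
Qed.

(** The powers of an element of infinite order commuting with [K] are
independent if the centre of [K] is finite: in a minimal relation the
coefficients lie in [K] and commute with [K], so they are taken from a finite
set; the powers of [q] then repeat. *)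
Lemma skew_independence_finite K q : divsub K -> q != 0 -> cent K q ->
  finite_set (Zc K) -> (forall n, (0 < n)%N -> q ^+ n <> 1) ->
  forall f, skewpoly K q f -> f.[1] = 0 -> f = 0.
Proof.
move=> dK q0 cq finZ nq f sf f1; apply: contrapT => f0.
have cjq x : K x -> cj q x = x by move=> Kx; apply/cj_id => //; apply: cq.
have cjVq x : K x -> cj q^-1 x = x.
  by move=> Kx; rewrite -{1}(cjq x Kx) cjK.
have [m [g [szg sg gm g1 cg]]] :=
  skew_dependence dK q0 (fun x Kx => eq_ind_r K Kx (cjq x Kx))
    (fun x Kx => eq_ind_r K Kx (cjVq x Kx)) sf f1 f0.
have dZ := divsub_Zc dK.
have cqn n : cent K (q ^+ n) by apply: (divsubX (divsub_cent K)).
pose c i := g`_i * (q ^+ i)^-1.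
have Zci i : Zc K (c i).
  split; first exact: sg.
  have -> : c i = g`_i * (q ^+ m)^-1 * (q ^+ m * (q ^+ i)^-1).
    by rewrite mulrA mulfVKd ?expd_neq0.
  apply: (divsubM (divsub_cent K)) => //; apply: (divsubM (divsub_cent K)) => //.
  exact: (divsubV (divsub_cent K)).
have cm : c m = 1 by rewrite /c gm mulfVd ?expd_neq0.
have qm : q ^+ m = - \sum_(i < m) c i * q ^+ i.
  have := g1; rewrite horner_coef szg big_ord_recr /= expr1n mulr1 gm addrC.
  move/eqP; rewrite addr_eq0 => /eqP->; congr (- _); apply: eq_bigr => i _.
  by rewrite expr1n mulr1 /c mulfVKd ?expd_neq0.
case: m {szg gm cg cm} qm => [|k] qk.
  by move: qk; rewrite big_ord0 oppr0 expr0 => /eqP; rewrite oner_eq0.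
pose V : set D := [set x | exists2 l : nat -> D, forall i, Zc K (l i) &
  x = \sum_(i < k.+1) l i * q ^+ i].
have finV : finite_set V.
  have /finite_seqP[s es] := finZ.
  have : finite_set [set \sum_i s`_(h i) * q ^+ i |
      h in [set: {ffun 'I_k.+1 -> 'I_(size s)}]].
    by apply: finite_image; apply: finite_finset.
  apply: sub_finite_set => _ [l Zl ->].
  have sl (i : 'I_k.+1) : l i \in s by have := Zl i; rewrite es.
  exists [ffun i : 'I_k.+1 => Ordinal (etrans (index_mem (l i) s) (sl i))] => //.
  by apply: eq_bigr => i _; rewrite ffunE /= nth_index.
have Vq x : V x -> V (x * q).
  move=> [l Zl ->].
  exists (fun i => (if i is j.+1 then l j else 0) - l k * c i) => [i|].
    apply: (divsubB dZ); last exact: (divsubM dZ).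
    by case: i => [|i]; [exact: (divsub0 dZ) | exact: Zl].
  rewrite (eq_bigr _ (fun i _ => mulrBl _ _ _)) sumrB.
  rewrite big_ord_recr /= mulrDl -mulrA -exprSr qk mulrN mulr_sumr.
  congr (_ - _); last by apply: eq_bigr => i _; rewrite mulrA.
  rewrite big_ord_recl /= mul0r add0r mulr_suml.
  by apply: eq_bigr => i _; rewrite -mulrA -exprSr.
have V1 n : V (q ^+ n).
  elim: n => [|n IH]; last by rewrite exprSr; apply: Vq.
  exists (fun i => (i == 0%N)%:R) => [i|]; first exact: (divsub_nat dZ).
  rewrite big_ord_recl big1 ?addr0 ?mul1r // => i _.
  by rewrite lift0 mul0r.
have [n n0 qn] := finite_torsion finV q0 V1.
exact: nq qn.
Qed.

End FieldCase.

(** * Centralizers of subnormal subgroups: finite centre *)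

Section FiniteCentre.
Variable D : divRing.
Implicit Types (x y z a b c e q t u v w : D) (H K G A B E L P Q M N R S : set D).
Implicit Types (f g h : {poly D}).

(** The product of the [X - q^i e q^-i] for [i < n], where [q^n] is meant to
commute with [e]. *)
Definition conjpoly q e n : {poly D} :=
  \prod_(i < n) ('X - (cj (q ^+ i) e)%:P).

Section ConjPoly.
Variables (E : set D) (q : D) (n : nat).
Hypotheses (dE : divsub E) (cE : E `<=` cent E) (q0 : q != 0) (n0 : (0 < n)%N).
Hypotheses (nE : forall x, E x -> E (cj q x)) (qn : cent E (q ^+ n)).

Let Ecj e i : E e -> E (cj (q ^+ i) e).
Proof.
move=> Ee; rewrite -iter_cj //; elim: i => [//|i IH].
by rewrite iterS; apply: nE.
Qed.

Lemma comm_XsubC x y : x * y = y * x ->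
  GRing.comm ('X - x%:P) ('X - y%:P : {poly D}).
Proof.
move=> xy; apply: commrB; apply/commr_sym; apply: commrB.
- exact: commr_refl.
- exact/commr_sym/commr_polyX.
- exact: commr_polyX.
- by rewrite /GRing.comm -!polyCM xy.
Qed.

Lemma size_conjpoly e : size (conjpoly q e n) = n.+1.
Proof. by rewrite size_prod_XsubC /index_enum -enumT size_enum_ord. Qed.

Lemma conjpoly_coef e i : E e -> E (conjpoly q e n)`_i.
Proof.
move=> Ee; have nK x : E x -> E (cj 1 x) by rewrite /cj mul1r invr1 mulr1.
suff : skewpoly E 1 (conjpoly q e n).
  by move=> /(_ i); rewrite /rcos expr1n invr1 mulr1.
apply: (big_ind (skewpoly E 1)).
- by apply: (skewC 1 dE); apply: (divsub1 dE).
- by move=> f g; apply: skewM => //; apply: oner_neq0.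
- move=> k _; apply: skewB => //; last by apply: (skewC 1 dE); apply: Ecj.
  move=> j; rewrite coefX /rcos expr1n invr1 mulr1.
  exact: divsub_nat.
Qed.

Lemma conjpolyE e : E e -> exists2 f, conjpoly q e n = ('X - e%:P) * f &
  conjpoly q e n = f * ('X - e%:P).
Proof.
move=> Ee; rewrite /conjpoly; case: n n0 => // k _.
have e0 : cj (q ^+ 0) e = e by rewrite /cj invr1 mulr1 mul1r.
rewrite big_ord_recl e0; exists (\prod_(i < k) ('X - (cj (q ^+ i.+1) e)%:P)) => //.
apply: commr_prod => i _; apply: comm_XsubC.
by apply: cE => //; apply: Ecj.
Qed.

Lemma root_conjpoly e : E e -> root (conjpoly q e n) e.
Proof.
by move=> Ee; apply/factor_theorem; have [f _ ->] := conjpolyE Ee; exists f.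
Qed.

Lemma mul_conjpoly x e m : x != 0 ->
  x%:P * \prod_(i < m) ('X - (cj (q ^+ i) e)%:P) =
  \prod_(i < m) ('X - (cj x (cj (q ^+ i) e))%:P) * x%:P :> {poly D}.
Proof.
move=> x0; elim: m => [|m IH]; first by rewrite !big_ord0 mulr1 mul1r.
rewrite !big_ord_recr /= mulrA IH -!mulrA; congr (_ * _).
by rewrite mulrBr mulrBl commr_polyX -!polyCM cj_swap.
Qed.

Lemma conjpoly_comm e : E e -> q%:P * conjpoly q e n = conjpoly q e n * q%:P.
Proof.
move=> Ee; rewrite mul_conjpoly //; congr (_ * _).
have qne : cj (q ^+ n) e = cj (q ^+ 0) e.
  rewrite {2}/cj expr0 invr1 mulr1 mul1r; apply/cj_id; first exact: expd_neq0.
  exact: qn.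
move: qne; rewrite /conjpoly; case: n n0 => // k _ qne.
rewrite big_ord_recr [RHS]big_ord_recl /= cjcj ?expd_neq0 // -exprS qne.
rewrite (eq_bigr (fun i : 'I_k => 'X - (cj (q ^+ (lift ord0 i)) e)%:P)); last first.
  by move=> i _; rewrite cjcj ?expd_neq0 // -exprS lift0.
apply/esym/commr_prod => i _; apply: comm_XsubC.
by apply: cE => //; apply: Ecj.
Qed.

Lemma conjpoly_coef_comm e i : E e ->
  q * (conjpoly q e n)`_i = (conjpoly q e n)`_i * q.
Proof.
move=> /conjpoly_comm /(congr1 (fun g : {poly D} => g`_i)).
by rewrite /= coefCM coefMC.
Qed.

(** The field [E] is finite as soon as the subfield fixed by [cj q] is. *)
Lemma finite_of_fixed : finite_set (E `&` cent [set q]) -> finite_set E.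
Proof.
move=> /finite_seqP[s es].
pose p (h : {ffun 'I_n.+1 -> 'I_(size s)}) : {poly D} :=
  \poly_(i < n.+1) s`_(h (inord i)).
pose RR (h : {ffun 'I_n.+1 -> 'I_(size s)}) :=
  if p h == 0 then set0 else [set x | E x /\ root (p h) x].
pose I := {ffun 'I_n.+1 -> 'I_(size s)}.
apply: (@sub_finite_set _ _ (\bigcup_(h in [set: I]) RR h)).
  move=> e Ee.
  have sc (i : 'I_n.+1) : (conjpoly q e n)`_i \in s.
    have : (E `&` cent [set q]) (conjpoly q e n)`_i.
      split; first exact: conjpoly_coef.
      by move=> _ ->; rewrite conjpoly_coef_comm.
    by rewrite es.
  pose h := [ffun i : 'I_n.+1 => Ordinal (etrans (index_mem _ s) (sc i))].
  have ph : p h = conjpoly q e n.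
    apply/polyP => i; rewrite coef_poly; case: ltnP => [im|im].
      by rewrite ffunE /= nth_index ?inordK // -[X in _`_X](inordK im); apply: sc.
    by rewrite nth_default // size_conjpoly.
  exists h => //; rewrite /RR ph -size_poly_eq0 size_conjpoly /=.
  by split=> //; apply: root_conjpoly.
apply: bigcup_finite => [|h _]; first exact: finite_finset.
by rewrite /RR; case: eqP => [_|/eqP ph]; [exact: finite_set0 | exact: finite_roots].
Qed.

(** Elements commuting with the fixed subfield map [e] to a root. *)
Lemma root_conjpoly_cj e x : E e -> x != 0 -> cent (E `&` cent [set q]) x ->
  root (conjpoly q e n) (cj x e).
Proof.
move=> Ee x0 cx; have [f _ ef] := conjpolyE Ee.
have xP : x%:P * conjpoly q e n = conjpoly q e n * x%:P.
  apply/polyP => i; rewrite coefCM coefMC; apply: cx; split.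
    exact: conjpoly_coef.
  by move=> _ ->; rewrite conjpoly_coef_comm.
apply/factor_theorem; exists (x%:P * f * (x^-1)%:P).
have -> : conjpoly q e n = x%:P * conjpoly q e n * (x^-1)%:P.
  by rewrite xP -mulrA -polyCM mulfVd // mulr1.
rewrite {1}ef !mulrA -!mulrA; congr (_ * (_ * _)).
rewrite mulrBl mulrBr -!polyCM commr_polyX; congr (_ - _%:P).
by rewrite /cj !mulrA mulVd // mul1r.
Qed.

End ConjPoly.

(** An element [q] of [Q] cannot act on a field [E], normalized by [Q], with a
finite order different from 1. The centralizer [A] of the fixed subfield and of
[q^n] has infinite centre, and [Q] meets it in a group under which the orbit of
[e] is finite. *)
Lemma finite_order_trivial p r Q E q n e : p \in [pchar D] -> divsub E ->
  E `<=` cent E -> subnorm setT r Q -> normed Q E -> Q q -> (0 < n)%N ->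
  cent E (q ^+ n) -> E e -> q * e = e * q.
Proof.
move=> cp dE cE sQ nQE Qq n0 qn Ee; apply: contrapT => nqe.
have dT : divsub (setT : set D) by apply: divsubT.
have gQ := subnorm_mgroup dT sQ; have q0 := mgroup_neq0 gQ Qq.
have nE x : E x -> E (cj q x) by apply: nQE.
have qn0 : q ^+ n != 0 by apply: expd_neq0.
pose L := E `&` cent [set q]; pose A := cent (L `|` [set q ^+ n]).
have dA : divsub A by apply: divsub_cent.
have EA : E `<=` A.
  move=> x Ex y [[Ey _]|->]; first exact: cE.
  by rewrite (qn x Ex).
have Aq : A q.
  move=> y [[_ cy]|->]; first by rewrite (cy q erefl).
  by rewrite -exprS exprSr.
have SZ : L `|` [set q ^+ n] `<=` Zc A.
  move=> x Sx; split; last by move=> y /(_ x Sx).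
  by case: Sx => [[Ex _]|->]; [exact: EA | exact: (divsubX dA)].
have infZ : infinite_set (Zc A).
  move=> finZ.
  have finL : finite_set L by apply: sub_finite_set finZ => x Lx; apply: SZ; left.
  have finE : finite_set E by apply: (finite_of_fixed dE cE q0 n0 nE qn).
  have [m m0 em] : exists2 m, (0 < m)%N & (q ^+ n) ^+ m = 1.
    apply: (finite_torsion finZ) => // i; apply: (divsubX (divsub_Zc dA)).
    by apply: SZ; right.
  have rE : subring E by case: dE => E1 EB EM _.
  apply: nqe; apply: (@finite_normal_comm _ E q (n * m)%N) => //.
    by rewrite muln_gt0 n0.
  by rewrite exprM.
have tA := trivial_centralizers_infinite dA infZ.
pose Q1 := Q `&` A.
have sQ1 : subnorm A r Q1 by apply: subnorm_restrict sQ.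
have gQ1 := subnorm_mgroup dA sQ1.
have Q1q : Q1 q by [].
pose O := [set cj x e | x in Q1].
have finO : finite_set O.
  have P0 : conjpoly q e n != 0 by rewrite -size_poly_eq0 size_conjpoly.
  apply: sub_finite_set (finite_roots P0 cE) => _ [x [Qx Ax] <-]; split.
    exact: nQE.
  apply: (root_conjpoly_cj dE cE q0 n0 nE qn) => //; first exact: mgroup_neq0 Qx.
  by move=> y Ly; apply: Ax; left.
have nO : normed Q1 O.
  move=> x _ Q1x [y Q1y <-]; exists (x * y); first exact: mgroupM.
  by rewrite cjcj //; apply: mgroup_neq0 gQ1 _ _.
have sH : subnorm A r.+1 (Q1 `&` cent O).
  apply: subnorm_step sQ1 _ _ _.
  - by apply: mgroupI_divsub => //; apply: divsub_cent.
  - by move=> x [].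
  - by apply: normedI; [move=> x y; apply: mgroup_cj | apply: normed_cent].
have Oe : O e by exists 1; [exact: mgroup1 | rewrite /cj mul1r invr1 mulr1].
have ceH : cent (Q1 `&` cent O) e by move=> x [_ cx]; rewrite (cx e Oe).
have [cH|ce] := tA _ _ _ sH (EA _ Ee) ceH; last by apply: nqe; rewrite (ce q Aq).
apply: nqe; apply: (asubnorm_central_by_finite dA tA (subnorm_asubnorm sQ1) _ Q1q).
  apply: fincolS (fincol_cent gQ1 finO nO) => // x Hx.
  by split; [case: Hx => [[]] | apply: cH].
exact: EA.
Qed.

Lemma word0 a r : word a 0 r = 0.
Proof.
elim: r => [//|r IH]; rewrite /word iterS -/(word a 0 r) IH.
by rewrite cj0 mul0r.
Qed.

(** In characteristic [p], a noncentral field normalized by a subnormal subgroup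
[Q] whose centralizer is the centre is not centralized by a noncentral subnormal
subgroup [M]. *)
Lemma normed_field_central p r s Q M E : p \in [pchar D] -> divsub E ->
  E `<=` cent E -> subnorm setT r Q -> subnorm setT s M -> M `<=` cent E ->
  normed Q E -> (forall x, cent Q x -> cent setT x) -> ~ (E `<=` cent setT) ->
  M `<=` cent setT.
Proof.
move=> cp dE cE sQ sM sMK nQE cQ ncE.
have dT : divsub (setT : set D) by apply: divsubT.
have gQ := subnorm_mgroup dT sQ; have gM := subnorm_mgroup dT sM.
have dK := divsub_cent E; have nQK := normed_cent gQ nQE.
apply: (nilpotent_delta_central dT dK sM gQ _ nQK sMK (r := s)) => //.
- apply: contrapT => none; apply: ncE => e Ee; apply: cQ => q Qq.
  have Kq : cent E q by apply: contrapT => Kq; apply: none; exists q.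
  by rewrite Kq.
- by move=> x _; apply: cQ.
move=> a q v Ma Qq Kq Kv; have a0 := mgroup_neq0 gM Ma.
have q0 := mgroup_neq0 gQ Qq.
have nK x : cent E x -> cent E (cj q x) by apply: nQK.
have nK' x : cent E x -> cent E (cj q^-1 x) by apply: nQK; apply: mgroupV.
apply: (word_const_delta dK (sMK _ Ma) a0 q0 nK _ Kv).
  apply: (skew_independence_field dK q0 nK nK' (centS cE)) => n n0 qn.
  apply: Kq => e Ee.
  exact: (finite_order_trivial cp dE cE sQ nQE Qq n0 qn Ee).
have [->|v1] := eqVneq (1 + v) 0; first by rewrite word0; apply: divsub0.
by apply: sMK; apply: (subnorm_word dT sM Ma).
Qed.

Lemma finite_centre_pchar : finite_set (Zc (setT : set D)) ->
  exists p, p \in [pchar D].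
Proof.
move=> finZ; apply: contrapT => none.
have dZ : divsub (Zc (setT : set D)) by apply: divsub_Zc; apply: divsubT.
have [i [j [ij e]]] := finite_repeat finZ (fun i => divsub_nat dZ i).
have /negP := @natr_neq0_pchar0 D (fun p cp => none (ex_intro _ p cp)) (j - i).-1.
by rewrite prednK ?subn_gt0 // natrB ?(ltnW ij) // e subrr eqxx; apply.
Qed.

(** With [E] the centralizer of [M] and [K] that of [E]: if the common centre of
[E] and [K] is not central, it is a field normalized by [Q]; otherwise it is
finite, [E] is not commutative and so contains elements of infinite order,
whose powers are independent over [K]. *)
Theorem trivial_centralizers_setT : trivial_centralizers (setT : set D).
Proof.
have dT : divsub (setT : set D) by apply: divsubT.
have [finZ|] := pselect (finite_set (Zc (setT : set D))); last first.
  exact: trivial_centralizers_infinite.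
have [p cp] := finite_centre_pchar finZ.
elim=> [|r IH] M k.
  move=> -> _ ck; right=> x _; have [->|x0] := eqVneq x 0.
    by rewrite mulr0 mul0r.
  exact: ck.
move=> sM _ ck; have [gM [Q [sQ sMQ nQM]]] := sM.
apply: contrapT => /not_orP[ncM nck].
have gQ := subnorm_mgroup dT sQ.
have cQ x : cent Q x -> cent setT x.
  by move=> /(IH _ _ sQ I)[cQ|//]; case: ncM => y /sMQ /cQ.
pose E := cent M; pose K := cent E; pose Z := E `&` K.
have nQE : normed Q E by apply: normed_cent.
have nQK : normed Q K by apply: normed_cent.
have dE : divsub E by apply: divsub_cent.
have dK : divsub K by apply: divsub_cent.
have sMK : M `<=` K by apply: cent_cent.
have [cZ|ncZ] := pselect (Z `<=` cent setT); last first.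
  apply: ncM; apply: (normed_field_central cp (divsubI dE dK) _ sQ sM) => //.
  - by move=> x [_ Kx] y [Ey _]; apply: Kx.
  - by apply: subset_trans sMK _; apply: centS => x [].
  - exact: normedI.
have [e [Ee e0 ord_e]] : exists e, [/\ E e, e != 0 &
    forall n, (0 < n)%N -> e ^+ n <> 1].
  apply: contrapT => none; apply: nck; apply: cZ; split=> // x Ex.
  apply: (torsion_comm cp dE) => // e Ee e0.
  apply: contrapT => tor; apply: none; exists e; split=> // n n0 en.
  by apply: tor; exists n.
have cKE : cent K `<=` E by apply: centS.
have cKe : cent K e by move=> x Kx; rewrite (Kx e Ee).
have nK x : K x -> K (cj e x).
  by move=> Kx; rewrite (_ : cj e x = x) //; apply/cj_id => //; apply: cKe.
have finK : finite_set (Zc K).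
  apply: sub_finite_set finZ => x [Kx cx]; split=> //.
  by apply: cZ; split=> //; apply: cKE.
have [n cn nP] := unipotent_exponent D r.+1.
apply: ncM; apply: (char_exponent_central dT sM cn) => a Ma; split=> //.
have a0 := mgroup_neq0 gM Ma.
apply: cZ; split; last by apply: sMK; apply: mgroupX.
apply: cKE; have [|//] := nP K a e dK (sMK _ Ma) a0 e0 nK.
move=> v Kv; apply: (word_const_delta dK (sMK _ Ma) a0 e0 nK _ Kv).
  exact: skew_independence_finite.
have [->|v1] := eqVneq (1 + v) 0; first by rewrite word0; apply: divsub0.
by apply: sMK; apply: (subnorm_word dT sM Ma).
Qed.

End FiniteCentre.

(** * Intersections of almost subnormal subgroups *)

Section Intersections.
Variable D : divRing.
Implicit Types (x y z a b c e q t u v w : D) (H K G A B E L P Q M N R S : set D).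

Let F : set D := cent setT.
Let dT : divsub (setT : set D) := @divsubT D.
Let tT := @trivial_centralizers_setT D.

(** A noncentral almost subnormal subgroup contains a noncentral subnormal one.
*)
Lemma asubnorm_noncentral_core r N : asubnorm setT r N -> ~ N `<=` F ->
  exists (k : nat) M, [/\ subnorm setT k M, M `<=` N & ~ M `<=` F].
Proof.
move=> aN ncN; have [k [M [sM sMN fM]]] := asubnorm_subnorm dT aN.
exists k, M; split=> // cM; apply: ncN.
apply: (asubnorm_central_by_finite dT tT aN).
by apply: fincolS fM => // x Mx; split=> //; apply: cM.
Qed.

(** If the commutators of [x] with [B] are central, then the centralizer of [x]
in [B] is normal in [B], hence subnormal. *)
Lemma central_commutators_centralizer r B x : subnorm setT r B ->
  ~ F x -> x != 0 -> (forall b, B b -> F (cj b x * x^-1)) ->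
  B `&` cent [set x] `<=` F.
Proof.
move=> sB ncx x0 cB; have gB := subnorm_mgroup dT sB.
suff sC : subnorm setT r.+1 (B `&` cent [set x]).
  have cx : cent (B `&` cent [set x]) x by move=> y [_ cy]; rewrite (cy x).
  by have [//|/ncx] := tT sC I cx.
apply: subnorm_step sB _ _ _.
- by apply: mgroupI_divsub => //; apply: divsub_cent.
- by move=> y [].
move=> g y Bg [By cy]; split; first exact: mgroup_cj.
move=> _ ->; have g0 := mgroup_neq0 gB Bg.
have Bg' := mgroupV gB Bg; have := cB _ Bg'; set l := _ * _ => Fl.
have e : cj g^-1 x = l * x by rewrite /l mulfVKd.
rewrite -[x](cjVK _ g0) -!(cjM _ _ g0) e; congr (cj g _).
by rewrite mulrA -(Fl y I) -mulrA (cy x) // mulrA.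
Qed.

Lemma noncentral_commutator r s A B : subnorm setT r A -> subnorm setT s B ->
  ~ A `<=` F -> ~ B `<=` F ->
  exists a b, [/\ A a, B b & ~ F (cj b a * a^-1)].
Proof.
move=> sA sB ncA ncB; apply: contrapT => none.
have gA := subnorm_mgroup dT sA; have gB := subnorm_mgroup dT sB.
have cAB a b : A a -> B b -> F (cj b a * a^-1).
  by move=> Aa Bb; apply: contrapT => nc; apply: none; exists a, b.
have [a Aa nca] : exists2 a, A a & ~ F a.
  apply: contrapT => n; apply: ncA => a Aa; apply: contrapT => nca.
  by apply: n; exists a.
have [b Bb ncb] : exists2 b, B b & ~ F b.
  apply: contrapT => n; apply: ncB => b Bb; apply: contrapT => ncb.
  by apply: n; exists b.
have a0 := mgroup_neq0 gA Aa; have b0 := mgroup_neq0 gB Bb.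
have Ca := central_commutators_centralizer sB nca a0 (fun b => cAB a b Aa).
suff cB g : B g -> F (cj g b * b^-1).
  by apply/ncb/(central_commutators_centralizer sB ncb b0 cB); split=> // _ ->.
move=> Bg; have g0 := mgroup_neq0 gB Bg; apply: Ca; split.
  by apply: mgroupM => //; [apply: mgroup_cj | apply: mgroupV].
have Fc x : F x -> forall h, h != 0 -> cj h x = x.
  by move=> Fx h h0; apply/cj_id => //; rewrite Fx.
have com h k : B h -> B k -> cj (h * k) a = cj (k * h) a.
  move=> Bh Bk; have h0 := mgroup_neq0 gB Bh; have k0 := mgroup_neq0 gB Bk.
  have E l : B l -> exists2 m, F m & cj l a = m * a.
    by move=> Bl; exists (cj l a * a^-1); [exact: cAB | rewrite mulfVKd].
  have [lh Fh eh] := E h Bh; have [lk Fk ek] := E k Bk.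
  rewrite -!cjcj // eh ek (cjM _ _ h0) (cjM _ _ k0) (Fc _ Fh) // (Fc _ Fk) //.
  by rewrite eh ek !mulrA (Fh lk).
move=> _ ->.
have -> : cj g b * b^-1 = g * b * (g^-1 * b^-1) by rewrite /cj !mulrA.
have gb0 : g * b != 0 by apply: mulfd_neq0.
have [g0' b0'] := (invd_neq0 g0, invd_neq0 b0).
apply/cj_id; first exact: (mulfd_neq0 gb0 (mulfd_neq0 g0' b0')).
rewrite -(cjcj a gb0 (mulfd_neq0 g0' b0')) (com _ _ (mgroupV gB Bg) (mgroupV gB Bb)).
by rewrite -invMd // cjVK.
Qed.

(** Two noncentral almost subnormal subgroups have a noncentral intersection, by
induction along the two chains: if [P] is normal in [P'] and [Q] in [Q'], the
commutators of [P' `&` Q] and [P `&` Q'] lie in [P `&` Q]. *)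
Theorem asubnorm_noncentralI i j P Q : asubnorm setT i P -> asubnorm setT j Q ->
  ~ P `<=` F -> ~ Q `<=` F -> ~ P `&` Q `<=` F.
Proof.
elim: i j P Q => [|i IHi].
  move=> j P Q aP aQ _ ncQ; rewrite aP (_ : _ `&` Q = Q) //.
  apply/seteqP; split=> [x []//|x Qx]; split=> //; split=> //.
  exact: mgroup_neq0 (asubnorm_mgroup dT aQ) _ Qx.
elim=> [|j IHj] P Q aP aQ ncP ncQ.
  rewrite aQ (_ : P `&` _ = P) //.
  apply/seteqP; split=> [x []//|x Px]; split=> //; split=> //.
  exact: mgroup_neq0 (asubnorm_mgroup dT aP) _ Px.
have [gP [P' [aP' sPP' stP]]] := aP; have [gQ [Q' [aQ' sQQ' stQ]]] := aQ.
have ncP' : ~ P' `<=` F by move=> cP'; apply: ncP => x /sPP' /cP'.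
have ncQ' : ~ Q' `<=` F by move=> cQ'; apply: ncQ => x /sQQ' /cQ'.
have nc1 : ~ P' `&` Q `<=` F by apply: IHi aP' aQ _ _.
have nc2 : ~ P `&` Q' `<=` F by apply: IHj.
have [k1 a1] := asubnormI dT aP' aQ; have [k2 a2] := asubnormI dT aP aQ'.
move=> cPQ.
have fin k R : asubnorm setT k R -> fincol (P `&` Q) R -> R `<=` F.
  move=> aR fR; apply: (asubnorm_central_by_finite dT tT aR).
  by apply: fincolS fR => // x PQx; split=> //; apply: cPQ.
case: stP => [nP|fP]; last by apply/nc1/(fin _ _ a1)/fincol_cap.
case: stQ => [nQ|fQ]; last first.
  by apply/nc2/(fin _ _ a2); rewrite setIC [P `&` Q']setIC; apply: fincol_cap.
have [l1 [M1 [sM1 sM1' ncM1]]] := asubnorm_noncentral_core a1 nc1.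
have [l2 [M2 [sM2 sM2' ncM2]]] := asubnorm_noncentral_core a2 nc2.
have [a [b [M1a M2b]]] := noncentral_commutator sM1 sM2 ncM1 ncM2; apply.
have [[P'a Qa] [Pb Q'b]] := (sM1' _ M1a, sM2' _ M2b).
apply: cPQ; split.
  rewrite (_ : _ * _ = b * cj a b^-1); last by rewrite /cj !mulrA.
  by apply: mgroupM => //; apply: nP => //; apply: mgroupV.
by apply: mgroupM (mgroupV _ Qa) => //; apply: nQ.
Qed.

End Intersections.

(** * From subgroups of the unit group to sets of ring elements *)

Section Translation.
Variable D : divRing.
Local Notation G := (unit_group D).
Implicit Types (H K N : set G) (u v : G).

(** The set of ring elements underlying a set of units. *)
Definition image_val N : set D := @unit_val D @` N.

Lemma unit_val_inj : injective (@unit_val D).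
Proof. exact: val_inj. Qed.

Lemma unit_valM u v : unit_val (u * v)%g = unit_val u * unit_val v.
Proof. by []. Qed.

Lemma unit_valV u : unit_val (u^-1)%g = (unit_val u)^-1.
Proof. by []. Qed.

Lemma unit_val_neq0 u : unit_val u != 0.
Proof. by apply: contraTneq (unit_valP u) => ->; rewrite unitr0. Qed.

Lemma unit_valJ u v : unit_val (v ^ u)%g = cj (unit_val u)^-1 (unit_val v).
Proof. by rewrite /conjg !unit_valM unit_valV /cj invrK mulrA. Qed.

Lemma image_valP N u : image_val N (unit_val u) <-> N u.
Proof. by split=> [[v Nv /unit_val_inj <-]//|Nu]; exists u. Qed.

Lemma subgroupP H : subgroup H <->
  [/\ H 1%g, forall u v, H u -> H v -> H (u * v)%g & forall u, H u -> H (u^-1)%g].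
Proof.
have inH u : (u \in [in H]) <-> H u.
  by split=> [uH|Hu]; [exact: (set_mem (uH : u \in H)) | exact: (mem_set Hu)].
split=> [gH|[H1 HM HV]].
  have [H1 _] := gH; have HM := group_closedM gH; have HV := group_closedV gH.
  split; first exact/inH.
    by move=> u v /inH uH /inH vH; apply/inH/HM.
  by move=> u /inH uH; apply/inH/HV.
split; first exact/inH.
by move=> u v /inH Hu /inH Hv; apply/inH/HM => //; apply: HV.
Qed.

Lemma mgroup_image H : subgroup H -> mgroup (image_val H).
Proof.
move=> /subgroupP[H1 HM HV]; split.
- by exists 1%g.
- by move=> _ [u _ <-]; apply: unit_val_neq0.
- by move=> _ _ [u Hu <-] [v Hv <-]; exists (u * v)%g; [exact: HM|].
- by move=> _ [u Hu <-]; exists (u^-1)%g; [exact: HV|].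
Qed.

Lemma image_valI H K : image_val (H `&` K) = image_val H `&` image_val K.
Proof.
apply/seteqP; split=> [_ [u [Hu Ku] <-]|x [[u Hu <-] /image_valP Ku]].
  by split; apply/image_valP.
by exists u.
Qed.

Lemma image_valT : image_val setT = mstar setT.
Proof.
apply/seteqP; split=> [_ [u _ <-]|x [_ x0]].
  by split=> //; apply: unit_val_neq0.
by exists (UnitGroup (divRing_unit x0)).
Qed.

Lemma normed_image H K : subgroup H -> normal_in K H ->
  normed (image_val H) (image_val K).
Proof.
move=> /subgroupP[_ _ HV] [_ nK] _ _ [u Hu <-] [v Kv <-].
have -> : cj (unit_val u) (unit_val v) = unit_val (v ^ u^-1)%g.
  by rewrite unit_valJ unit_valV invrK.
by apply/image_valP/nK => //; apply: HV.
Qed.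

Lemma fincol_image H K : subgroup K -> finite_index H K ->
  fincol (image_val K) (image_val H).
Proof.
move=> /subgroupP[K1 _ _] [sKH /finite_seqP[s es]].
have [h hK] : exists h : D -> G, cancel (@unit_val D) h.
  by exists (insubd (1%g : G)) => u; apply: valKd.
pose g (x : D) : 'I_(size s).+1 := inord (index (lcoset (h x) K) s).
exists 'I_(size s).+1, g => _ _ [u Hu <-] [v Hv <-] /(congr1 val).
have sH w : H w -> lcoset w K \in s.
  move=> Hw; have : [set lcoset x K | x in H] (lcoset w K) by exists w.
  by rewrite es.
rewrite /g /= !hK !inordK ?ltnS ?index_size // => e.
have {}e : lcoset u K = lcoset v K.
  by rewrite -(nth_index set0 (sH _ Hu)) e nth_index //; apply: sH.
have [k Kk ek] : lcoset u K v by rewrite e; exists 1%g; rewrite ?mulg1.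
by exists k => //; rewrite -ek unit_valM mulKd ?unit_val_neq0.
Qed.

Lemma asubnorm_image N : almost_subnormal N ->
  exists r, asubnorm setT r (image_val N).
Proof.
move=> [r [c [c0 cr gc stc]]]; exists r; rewrite -cr.
suff aux i : (i <= r)%N -> asubnorm setT i (image_val (c i)) by apply: aux.
elim: i => [|i IH] ir; first by rewrite c0 image_valT.
split; first exact/mgroup_image/gc.
have [sc st] := stc _ ir; exists (image_val (c i)); split.
- exact/IH/ltnW.
- by move=> _ [u /sc cu <-]; apply/image_valP.
case: st => [nc|fc]; [left|right].
  by apply: normed_image nc; apply/gc/ltnW.
by apply: fincol_image fc; apply/gc.
Qed.

Lemma non_centralP N : non_central N <-> ~ (image_val N `<=` cent setT).
Proof.
by split=> nc cN; apply: nc => x /cN cx y; [|move=> _]; apply: cx.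
Qed.

(** * The derived subgroup *)

Local Notation D' := (derived_subgroup G).

Lemma subgroupI H K : subgroup H -> subgroup K -> subgroup (H `&` K).
Proof.
move=> /subgroupP[H1 HM HV] /subgroupP[K1 KM KV]; apply/subgroupP; split=> //.
  by move=> u v [? ?] [? ?]; split; [apply: HM | apply: KM].
by move=> u [? ?]; split; [apply: HV | apply: KV].
Qed.

Lemma subgroupT : subgroup [set: G].
Proof. exact/subgroupP. Qed.

Lemma subgroup_derived : subgroup D'.
Proof.
apply/subgroupP; split.
- by move=> H [/subgroupP[]].
- move=> u v Du Dv H sH; have [/subgroupP[_ HM _] _] := sH.
  by apply: HM; [apply: Du | apply: Dv].
- move=> u Du H sH; have [/subgroupP[_ _ HV] _] := sH.
  exact: (HV _ (Du _ sH)).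
Qed.

Lemma mem_derived u v : D' [~ u, v]%g.
Proof. by move=> H [_]; apply; exists u => //; exists v. Qed.

Lemma normal_of_derived N : subgroup N -> D' `<=` N -> normal_in N setT.
Proof.
move=> /subgroupP[_ NM _] sDN; split=> // x y _ Ny.
have -> : (y ^ x = y * [~ y, x])%g by rewrite /commg mulVKg.
exact: (NM _ _ Ny (sDN _ (mem_derived y x))).
Qed.

Lemma normal_derived : normal_in D' setT.
Proof. exact: normal_of_derived subgroup_derived _. Qed.

Lemma lcosetI x H K : subgroup K -> K x ->
  lcoset x (H `&` K) = lcoset x H `&` K.
Proof.
move=> /subgroupP[_ KM KV] Kx; apply/seteqP; split.
  by move=> _ [y [Hy Ky] <-]; split; [exists y | apply: KM].
move=> _ [[y Hy <-] Kxy]; exists y => //; split=> //.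
by rewrite -[y](mulKg x); apply: KM => //; apply: KV.
Qed.

(** Intersecting with the derived subgroup preserves almost subnormality. *)
Lemma almost_subnormal_derived N : almost_subnormal N ->
  almost_subnormal (N `&` D').
Proof.
move=> [r [c [c0 cr gc stc]]].
exists r.+1, (fun i => if i is j.+1 then c j `&` D' else setT).
have gD := subgroup_derived.
split=> //; first by rewrite cr.
  by move=> [|i] ir; [exact: subgroupT | apply: subgroupI => //; apply: gc].
move=> [|i] ir.
  by rewrite c0 setTI; split=> //; left; apply: normal_derived.
have [sc st] := stc _ ir; split; first exact: setSI.
case: st => [[_ nc]|[_ fc]]; [left|right]; split; try exact: setSI.
  move=> x y [cx Dx] [cy Dy]; split; first exact: nc.
  by case: normal_derived => _; apply.
apply: sub_finite_set (finite_image (fun C => C `&` D') fc).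
move=> _ [x [cx Dx] <-]; exists (lcoset x (c i.+1)); first by exists x.
by rewrite lcosetI.
Qed.

Lemma almost_subnormal_derived_subgroup : almost_subnormal D'.
Proof.
have := @almost_subnormal_derived setT; rewrite setTI; apply.
by exists 0%N, (fun=> setT); split=> // i _; apply: subgroupT.
Qed.

Hypothesis ncD : ~ (forall x y : D, x * y = y * x).

Lemma non_central_derived : non_central D'.
Proof.
apply/non_centralP => cD; have dT := @divsubT D.
have ncT : ~ mstar (setT : set D) `<=` cent setT.
  move=> cT; apply: ncD => x y; have [->|x0] := eqVneq x 0.
    by rewrite mulr0 mul0r.
  exact: cT.
have sT : subnorm setT 0 (mstar (setT : set D)) by [].
have [a [b []]] := noncentral_commutator sT sT ncT ncT.
rewrite -image_valT => -[u _ <-] [v _ <-]; apply; apply: cD.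
have -> : cj (unit_val v) (unit_val u) * (unit_val u)^-1 =
    unit_val [~ v^-1, u^-1]%g.
  by rewrite /commg /conjg !unit_valM !unit_valV !invrK /cj !mulrA.
by apply/image_valP; apply: mem_derived.
Qed.

Lemma non_centralI M N : almost_subnormal M -> almost_subnormal N ->
  non_central M -> non_central N -> non_central (M `&` N).
Proof.
move=> /asubnorm_image[r aM] /asubnorm_image[s aN].
move=> /non_centralP ncM /non_centralP ncN; apply/non_centralP.
by rewrite image_valI; apply: asubnorm_noncentralI aM aN _ _.
Qed.

Lemma infinite_almost_subnormal N : almost_subnormal N -> non_central N ->
  ~ finite_set N.
Proof.
move=> /asubnorm_image[r aN] /non_centralP ncN finN; apply: ncN.
apply: (asubnorm_central_by_finite (divsubT D) (@trivial_centralizers_setT D) aN).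
have dT := @divsubT D; have gN := asubnorm_mgroup dT aN.
have /finite_seqP[s es] : finite_set (image_val N) by apply: finite_image.
pose g (x : D) : 'I_(size s).+1 := inord (index x s).
exists 'I_(size s).+1, g => x y Nx Ny /(congr1 val).
rewrite /= !inordK ?ltnS ?index_size // => e.
have sN z : image_val N z -> z \in s by rewrite es.
have {e} -> : x = y by rewrite -(nth_index 0 (sN _ Nx)) e nth_index //; apply: sN.
rewrite mulVd; last exact: mgroup_neq0 gN _ Ny.
exact: divsub1 (divsub_Zc dT).
Qed.

Lemma non_central_neq1 N : non_central N -> N <> [set 1%g].
Proof.
move=> nc e; apply: nc; rewrite e => _ [_ -> <-] y.
by rewrite mul1r mulr1.
Qed.

End Translation.

Theorem theorem2p7 (D : unitRingType)
    (D_division : forall x : D, x != 0 -> x \is a GRing.unit)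
    (D_noncomm : ~ (forall x y : D, x * y = y * x)) :
  [/\ complete (Delta D),
      forall N : set (unit_group D), vertices (Delta D) N ->
        normal_in N setT \/
        (proper_subgroup (N `&` derived_subgroup (unit_group D))
                         (derived_subgroup (unit_group D)) /\
         vertices (Delta D) (N `&` derived_subgroup (unit_group D)))
    & forall N : set (unit_group D), vertices (Delta D) N -> ~ finite_set N].
Proof.
pose D0 := DivRing D_division; split.
- move=> M N [VM [ncM asM]] [VN [ncN asN]] nMN; split=> //; split=> //.
  exact: (@non_central_neq1 D0 _ (@non_centralI D0 _ _ asM asN ncM ncN)).
- move=> N [[[gN _ NT] _] [ncN asN]].
  have [sDN|nDN] := pselect (derived_subgroup (unit_group D) `<=` N).
    by left; apply: (@normal_of_derived D0).
  right; have gI := @subgroupI D0 _ _ gN (subgroup_derived D0).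
  have nc := @non_centralI D0 _ _ asN (almost_subnormal_derived_subgroup D0) ncN
    (@non_central_derived D0 D_noncomm).
  split; first by split=> // e; apply: nDN; rewrite -e => x [].
  split; last by split=> //; apply: (@almost_subnormal_derived D0).
  split; last exact: (@non_central_neq1 D0 _ nc).
  split=> // e; apply: NT; apply/seteqP; split=> // x _.
  by have : [set: unit_group D] x by []; rewrite -e => -[].
- by move=> N [_ [ncN asN]]; apply: (@infinite_almost_subnormal D0).
Qed.
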